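(* Let $n>1$ be an odd integer. For integers $k\geq 0$ define $$c_q(k)=(-1)^k\frac{(1+q^{4k+1})(q^{2};q^{4})^3_k}{(1+q)(q^{4};q^{4})^3_k}q^{2k^2+2k}.$$ Then, modulo $\Phi_n(-q)^4\Phi_n(q)^2$, $$\sum_{k=0}^{n-1}\sum_{j=0}^{k}c_q(j)c_q(k-j)\equiv [n]^2_{q^2}\,q^{(n-1)^2}\bigg(\sum_{k=0}^{\frac{n-1}{2}}\frac{(q^{2};q^{4})^3_k}{(q^{4},q^{3},q^{5};q^{4})_k}q^{2k}\bigg)^2.$$
   Context: Here $q$ is an indeterminate. The $q$-shifted factorial is $(a;q)_0=1$, $(a;q)_m=(1-a)(1-aq)\cdots(1-aq^{m-1})$ for $m\geq1$, and $(a_1,\dots,a_s;q)_m=(a_1;q)_m\cdots(a_s;q)_m$. $[m]_{q^2}=1+q^2+\cdots+q^{2(m-1)}$. $\Phi_n(q)$ denotes the $n$-th cyclotomic polynomial in $q$. A congruence between rational functions in $q$ modulo a polynomial $P(q)$ means that the numerator of the difference (in reduced form) is divisible by $P(q)$ while its denominator is coprime to $P(q)$. *)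

(* Defs.v *)
From mathcomp Require Import all_boot all_order all_algebra all_field.

Set Implicit Arguments.
Unset Strict Implicit.
Unset Printing Implicit Defensive.

Import GRing.Theory.
Local Open Scope ring_scope.

Definition qpoch (K : fieldType) (a q : K) (m : nat) : K :=
  \prod_(i < m) (1 - a * q ^+ i).

Definition qpochs (K : fieldType) (s : seq K) (q : K) (m : nat) : K :=
  \prod_(a <- s) qpoch a q m.

Definition qint (K : fieldType) (m : nat) (q : K) : K :=
  \sum_(i < m) q ^+ i.

Notation ratfun := {fraction {poly rat}}.

Definition qvar : ratfun := FracField.tofrac ('X : {poly rat}).

(* Congruence of rational functions: the difference is written in lowest terms
   as a / b.  Two such representations differ by a nonzero rational scalar, so
   the two conditions relating a and b to P do not depend on the choice. *)
Definition congr_ratfun (P : {poly rat}) (f g : ratfun) : Prop :=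
  exists a b : {poly rat},
    [/\ b != 0, coprimep a b,
        f - g = FracField.tofrac a / FracField.tofrac b,
        P %| a & coprimep b P].

Definition cyclotomic_rat (n : nat) : {poly rat} :=
  map_poly (intr : int -> rat) 'Phi_n.

Definition c_q (k : nat) : ratfun :=
  let q := qvar in
  (-1) ^+ k
  * ((1 + q ^+ (4 * k + 1)) * qpoch (q ^+ 2) (q ^+ 4) k ^+ 3
     / ((1 + q) * qpoch (q ^+ 4) (q ^+ 4) k ^+ 3))
  * q ^+ (2 * k ^ 2 + 2 * k).

(* Main.v *)
Require Import Defs.
From mathcomp Require Import all_boot all_order all_algebra all_field.
From mathcomp Require Import ring zify.

(* Write n = 2N + 1, S for the sum of c_q(k) over k <= N, and R for a square root
   of the right-hand side.  Since c_q(k) is divisible by (1 - q^(2n))^3 for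
   N < k < n, the double sum is S^2 plus twice a cross term that is a multiple of
   (1 - q^(2n))^3.

   Deform S and R by a parameter x, replacing (q^2;q^4)_k^2 by
   (x q^2, q^2/x; q^4)_k and (q^4;q^4)_k^2 by (x q^4, q^4/x; q^4)_k.  Both become
   functions of t = x + 1/x, and at x = q^(2n) they agree by a terminating case of
   Watson's transformation, itself obtained by expanding one factor with the
   q-Saalschutz sum and summing the resulting 6phi5 series.  As
   2 - q^(2n) - q^(-2n) = - q^(-2n) (1 - q^(2n))^2, S - R is a multiple of
   (1 - q^(2n))^2.

   At q = - zeta with zeta of order n, the deformed terms are antisymmetric under
   k -> N - k, so the deformed S vanishes identically, and so does the deformed R
   because of [n]_{q^2}; this gives one more factor Phi_n(-q) in S - R, S + R and
   the cross term.  The orders at the two cyclotomic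
   factors are computed by evaluation at - zeta and zeta in algC. *)

Set Implicit Arguments.
Unset Strict Implicit.
Unset Printing Implicit Defensive.

Import GRing.Theory.
Local Open Scope ring_scope.

(** * Shifted factorials: recurrences and splitting *)

Section Qpoch.
Variable K : fieldType.
Implicit Types a p q : K.

Lemma qpoch0 a q : qpoch a q 0 = 1.
Proof. by rewrite /qpoch big_ord0. Qed.

Lemma qpochS a q m : qpoch a q m.+1 = qpoch a q m * (1 - a * q ^+ m).
Proof. by rewrite /qpoch big_ord_recr. Qed.

Lemma qpochSl a q m : qpoch a q m.+1 = (1 - a) * qpoch (a * q) q m.
Proof.
rewrite /qpoch big_ord_recl expr0 mulr1; congr (_ * _).
by apply: eq_bigr => i _; rewrite -mulrA -exprS.
Qed.

Lemma qpochD a q m k :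
  qpoch a q (m + k) = qpoch a q m * qpoch (a * q ^+ m) q k.
Proof.
elim: k => [|k IH]; first by rewrite addn0 qpoch0 mulr1.
by rewrite addnS !qpochS IH exprD !mulrA.
Qed.

Lemma qpoch_neq0 a q m :
  (forall i, (i < m)%N -> 1 - a * q ^+ i != 0) -> qpoch a q m != 0.
Proof. by move=> h; apply/prodf_neq0 => i _; apply: h. Qed.

End Qpoch.

(** * A terminating very-well-poised 6phi5 sum *)

Section VeryWellPoised.
Variables (K : fieldType) (p : K).

(* The very-well-poised terminating 6phi5 with one parameter sent to infinity;
   [e] is the inverse of the remaining free parameter, so that [e = 0] is
   allowed, and [(p^-N;p)_k] is rescaled to [\prod_(i < k) (1 - p^(N-i))]. *)
Definition vwp_term a e N k : K :=
  (1 - a * p ^+ (2 * k))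
  * (qpoch a p k * (\prod_(i < k) (e - p ^+ i))
     * \prod_(i < k) (1 - p ^+ (N - i)))
  / (qpoch p p k * qpoch (a * p * e) p k * qpoch (a * p ^+ N.+1) p k)
  * (p ^+ (k * k) * a ^+ k).

Variables a e : K.
Hypothesis p_gen : forall i, 1 - p ^+ i.+1 != 0.
Hypothesis a_gen : forall i, 1 - a * p ^+ i != 0.
Hypothesis e_gen : forall i, 1 - a * p * e * p ^+ i != 0.

Lemma qpoch_pp_neq0 k : qpoch p p k != 0.
Proof. by apply: qpoch_neq0 => i _; rewrite -exprS. Qed.

(* A Wilf-Zeilberger certificate for the induction on [N]. *)
Lemma vwp_telescope N k : (k <= N.+1)%N ->
  \sum_(i < k.+1) (vwp_term a e N.+1 i * (1 - a * p * e * p ^+ N)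
                   - (1 - a * p ^+ N.+1) * vwp_term a e N i)
  = - (a * p ^+ N.+1 * p ^+ k * (p ^+ (k * k) * a ^+ k))
    * (qpoch a p k.+1 * (\prod_(i < k.+1) (e - p ^+ i))
       * \prod_(i < k) (1 - p ^+ (N - i)))
    / (qpoch p p k * qpoch (a * p * e) p k * qpoch (a * p ^+ N.+2) p k).
Proof.
elim: k => [_|k IH lt_kN].
  rewrite !big_ord_recr !big_ord0 /vwp_term /= !big_ord0 /=.
  rewrite !qpochS !qpoch0 !exprS !expr0 !mulr1 !mul1r !invr1.
  by ring.
rewrite big_ord_recr IH /=; last exact: ltnW.
rewrite /vwp_term.
have le_kN : (k <= N)%N by [].
have -> : \prod_(i < k.+1) (1 - p ^+ (N.+1 - i))
   = (1 - p ^+ N.+1) * \prod_(i < k) (1 - p ^+ (N - i)).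
  by rewrite big_ord_recl subn0; congr (_ * _); apply: eq_bigr => i _; rewrite subSS.
have -> : qpoch (a * p ^+ N.+1) p k.+1
          = (1 - a * p ^+ N.+1) * qpoch (a * p ^+ N.+2) p k.
  by rewrite qpochSl -mulrA -exprSr.
rewrite [\prod_(i < k.+1) (1 - p ^+ (N - i))]big_ord_recr /=.
rewrite ![\prod_(i < _.+1) (e - _)]big_ord_recr /=.
rewrite !qpochS.
have := a_gen N.+1.
have := a_gen (N.+2 + k); have := e_gen k; have := p_gen k.
have: qpoch (a * p ^+ N.+2) p k != 0.
  by apply: qpoch_neq0 => i _; rewrite -mulrA -exprD.
have: qpoch (a * p * e) p k != 0 by apply: qpoch_neq0.
have: qpoch p p k != 0 by apply: qpoch_pp_neq0.
have -> : p ^+ (k.+1 * k.+1) = p ^+ (k * k) * p ^+ k * p ^+ k * p.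
  by rewrite -!exprD -exprSr; congr (_ ^+ _); lia.
have -> : p ^+ (2 * k.+1) = p ^+ k * p ^+ k * p * p.
  by rewrite -!exprD -!exprSr; congr (_ ^+ _); lia.
rewrite exprD !exprS (_ : p ^+ N = p ^+ k * p ^+ (N - k)); last first.
  by rewrite -exprD subnKC.
set W := qpoch (a * _) p k.
move: (qpoch p p k) (qpoch (a * p * e) p k) W (qpoch a p k)
  (\prod_(i < k) (e - p ^+ i)) (\prod_(i < k) (1 - p ^+ (N - i)))
  (p ^+ k) (p ^+ (N - k)) (p ^+ (k * k)) (a ^+ k).
move=> B1 B2 B3 B4 B5 B6 X Y Z U n1 n2 n3 n4 n5 n6 n7.
field.
by rewrite n1 n2 n3 n4 n5 n7 -[_ * X]mulrA n6.
Qed.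

(** At [k = N.+1] the telescoped right-hand side vanishes, leaving a first-order recurrence in [N]
    that the closed form also satisfies. *)
Lemma vwp_sum N :
  \sum_(k < N.+1) vwp_term a e N k = qpoch a p N.+1 / qpoch (a * p * e) p N.
Proof.
elim: N => [|N IH].
  rewrite big_ord1 /vwp_term !big_ord0 !qpochS !qpoch0 !expr0.
  by field; rewrite oner_eq0.
(* The last factor is [1 - p ^+ 0]; it kills both the boundary term and the extra summand [k = N.+1]
   at level [N]. *)
have van : \prod_(i < N.+1) (1 - p ^+ (N - i)) = 0.
  by rewrite big_ord_recr /= subnn subrr mulr0.
have shorter : \sum_(k < N.+2) vwp_term a e N k
               = qpoch a p N.+1 / qpoch (a * p * e) p N.
  by rewrite big_ord_recr IH /= /vwp_term van !mulr0 !mul0r addr0.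
have := vwp_telescope (leqnn N.+1).
rewrite van !mulr0 mul0r sumrB -mulr_suml -mulr_sumr shorter.
move=> /eqP; rewrite subr_eq0 => /eqP h.
apply: (mulIf (e_gen N)); rewrite h [in RHS]qpochS.
rewrite [qpoch (a * p * e) p N.+1 in RHS]qpochS.
have := e_gen N; have: qpoch (a * p * e) p N != 0 by exact: qpoch_neq0.
by move=> h1 h2; field; rewrite h1 h2.
Qed.

End VeryWellPoised.

(** * A q-Saalschutz sum in base q^4 *)

Section Saalschutz.
Variables (K : fieldType) (q : K).
Hypothesis q_neq0 : q != 0.
Hypothesis q_gen : forall m, 1 - q ^+ m.+1 != 0.

(** Summand of the 3phi2 with upper parameters q^(-4k), q^(4k+2), q^2, lower parameters q^3, q^5,
    base and argument q^4; it is balanced because q^(-4k) q^(4k+2) q^2 q^4 = q^3 q^5. *)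
Definition saal_term k j : K :=
  qpoch ((q ^+ (4 * k))^-1) (q ^+ 4) j * qpoch (q ^+ (4 * k + 2)) (q ^+ 4) j
  * qpoch (q ^+ 2) (q ^+ 4) j
  / (qpoch (q ^+ 4) (q ^+ 4) j * qpoch (q ^+ 3) (q ^+ 4) j
     * qpoch (q ^+ 5) (q ^+ 4) j) * q ^+ (4 * j).

Lemma qpochX_neq0 m d k : qpoch (q ^+ m.+1) (q ^+ d) k != 0.
Proof. by apply: qpoch_neq0 => i _; rewrite -exprM -exprD addSn. Qed.

(* A Wilf-Zeilberger certificate for the induction on [k]. *)
Lemma saal_telescope k m :
  \sum_(j < m.+1) (saal_term k.+1 j * (1 - q ^+ (4 * k + 5))
                   - saal_term k j * q ^+ 2 * (1 - q ^+ (4 * k + 1)))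
  = (1 + q ^+ (4 * k + 3))
    * (qpoch ((q ^+ (4 * k))^-1) (q ^+ 4) m * qpoch (q ^+ (4 * k + 6)) (q ^+ 4) m
       * qpoch (q ^+ 2) (q ^+ 4) m.+1
  / (qpoch (q ^+ 4) (q ^+ 4) m * qpoch (q ^+ 3) (q ^+ 4) m
     * qpoch (q ^+ 5) (q ^+ 4) m)).
Proof.
elim: m => [|m IH].
  rewrite big_ord1 /saal_term !qpochS !qpoch0 !exprD !muln0 !expr0.
  by field; rewrite oner_eq0.
rewrite big_ord_recr IH /= /saal_term.
have Ek : q ^+ (4 * k.+1) = q ^+ (4 * k) * q ^+ 4 by rewrite -exprD mulnSr.
have -> : qpoch (q ^+ (4 * k.+1))^-1 (q ^+ 4) m.+1
   = (1 - (q ^+ (4 * k) * q ^+ 4)^-1) * qpoch (q ^+ (4 * k))^-1 (q ^+ 4) m.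
  by rewrite qpochSl Ek invfM mulfVK // expf_neq0.
have -> : qpoch (q ^+ (4 * k + 2)) (q ^+ 4) m.+1
   = (1 - q ^+ (4 * k + 2)) * qpoch (q ^+ (4 * k + 6)) (q ^+ 4) m.
  by rewrite qpochSl -exprD -addnA.
have -> : (4 * k.+1 + 2 = 4 * k + 6)%N by lia.
rewrite !(qpochS _ _ m) (qpochS _ _ m.+1) qpochS.
have := qpochX_neq0 3 4 m; have := qpochX_neq0 2 4 m; have := qpochX_neq0 4 4 m.
have := q_gen (4 * m + 3); have := q_gen (4 * m + 2); have := q_gen (4 * m + 4).
have Em : q ^+ (4 * m.+1) = q ^+ (4 * m) * q ^+ 4 by rewrite -exprD mulnSr.
have : q ^+ (4 * k) != 0 by rewrite expf_neq0.
rewrite -!exprM Em -!addnS !(exprD _ (4 * k)) !(exprD _ (4 * m)).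
move: (qpoch (q ^+ 4) (q ^+ 4) m) (qpoch (q ^+ 3) (q ^+ 4) m)
  (qpoch (q ^+ 5) (q ^+ 4) m) (qpoch (q ^+ 2) (q ^+ 4) m)
  (qpoch ((q ^+ (4 * k))^-1) (q ^+ 4) m).
set W := qpoch (_ * _) _ _.
move: W (q ^+ (4 * k)) (q ^+ (4 * m)) => W X Y B1 B2 B3 B4 B5 h1 h2 h3 h4 h5 h6 h7.
field.
by rewrite !(mulrC _ Y) h2 h3 h4 h5 h6 h7 h1 q_neq0.
Qed.

(** With [m = k.+1] in the telescoped identity the factor (q^(-4k);q^4)_(k+1) is zero, so the sums
    for [k] and [k.+1] are proportional. *)
Lemma saal_sum k :
  \sum_(j < k.+1) saal_term k j
  = q ^+ (2 * k) * (1 - q) / (1 - q ^+ (4 * k + 1)).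
Proof.
have nz k' : 1 - q ^+ (4 * k' + 1) != 0 by rewrite addn1.
have q40 k' : q ^+ (4 * k') != 0 by rewrite expf_neq0.
have van k' : qpoch (q ^+ (4 * k'))^-1 (q ^+ 4) k'.+1 = 0.
  by rewrite qpochS -exprM mulVf // subrr mulr0.
elim: k => [|k IH].
  rewrite big_ord1 /saal_term !qpoch0 !muln0 !expr0 expr1.
  have := q_gen 0; rewrite expr1 => q1.
  by field; rewrite oner_eq0 q1.
have := saal_telescope k k.+1.
rewrite van !mul0r mulr0 sumrB -!mulr_suml.
move/eqP; rewrite subr_eq0 => /eqP h.
have e5 : (4 * k + 5 = 4 * k.+1 + 1)%N by lia.
apply: (mulIf (nz k.+1)); rewrite -e5 h big_ord_recr IH /=.
rewrite [saal_term _ _]/saal_term van !mul0r addr0.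
have h2 := nz k; have := nz k.+1; rewrite -e5 => h1.
have -> : (2 * k.+1 = 2 * k + 2)%N by lia.
by rewrite (exprD _ (2 * k)); field; rewrite h2 h1.
Qed.

End Saalschutz.

(** * The terminating case of Watson's transformation *)

Section Watson.
Variables (K : fieldType) (q : K).
Hypothesis q_neq0 : q != 0.
Hypothesis q_gen : forall m, 1 - q ^+ m.+1 != 0.

Lemma sub1_expf_div_neq0 i j : i != j -> 1 - q ^+ i / q ^+ j != 0.
Proof.
have q0 k : q ^+ k != 0 by rewrite expf_neq0.
move=> ne_ij; rewrite subr_eq0 -(inj_eq (mulIf (q0 j))) mul1r divfK //.
wlog lt_ij : i j ne_ij / (i < j)%N => [wl|].
  case: (ltngtP i j) ne_ij => // [lt_ij|lt_ji] _; first by rewrite wl // ltn_eqF.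
  by rewrite eq_sym wl // ltn_eqF.
rewrite -(subnKC lt_ij) addSnnS exprD -subr_eq0 -{2}[q ^+ i]mulr1 -mulrBr.
by rewrite mulf_eq0 negb_or q0 -opprB oppr_eq0 q_gen.
Qed.

(** Ratio in the outer index, since after the interchange of summations [j] is fixed and [k] runs.
    The bound on [j] keeps 1 - q^(4j-4k-4) nonzero. *)
Lemma saal_shift k j : (j <= k)%N ->
  saal_term q k.+1 j
  = saal_term q k j * ((1 - (q ^+ (4 * k.+1))^-1) * (1 - q ^+ (4 * k + 2) * q ^+ (4 * j))
       / ((1 - q ^+ (4 * k + 2)) * (1 - q ^+ (4 * j) / q ^+ (4 * k.+1)))).
Proof.
move=> le_jk; rewrite /saal_term.
have q40 i : q ^+ i != 0 by rewrite expf_neq0.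
have n1 : 1 - q ^+ (4 * j) / q ^+ (4 * k.+1) != 0 by apply: sub1_expf_div_neq0; lia.
have n2 : 1 - q ^+ (4 * k + 2) != 0 by rewrite addnS q_gen.
have e1 : (1 - (q ^+ (4 * k.+1))^-1) * qpoch (q ^+ (4 * k))^-1 (q ^+ 4) j
  = qpoch (q ^+ (4 * k.+1))^-1 (q ^+ 4) j * (1 - q ^+ (4 * j) / q ^+ (4 * k.+1)).
  rewrite [q ^+ (4 * j) / _]mulrC (exprM q 4 j) -qpochS qpochSl; congr (_ * qpoch _ _ _).
  by rewrite mulnSr exprD invfM mulfVK.
have e2 : qpoch (q ^+ (4 * k + 2)) (q ^+ 4) j * (1 - q ^+ (4 * k + 2) * q ^+ (4 * j))
  = (1 - q ^+ (4 * k + 2)) * qpoch (q ^+ (4 * k.+1 + 2)) (q ^+ 4) j.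
  rewrite (exprM q 4 j) -qpochS qpochSl; congr (_ * qpoch _ _ _).
  by rewrite -exprD; congr (_ ^+ _); lia.
rewrite -[X in X = _](mulfK (mulf_neq0 n2 n1)).
rewrite [RHS]mulrA; congr (_ / _).
transitivity
  ((qpoch (q ^+ (4 * k.+1))^-1 (q ^+ 4) j * (1 - q ^+ (4 * j) / q ^+ (4 * k.+1)))
   * ((1 - q ^+ (4 * k + 2)) * qpoch (q ^+ (4 * k.+1 + 2)) (q ^+ 4) j)
   * (qpoch (q ^+ 2) (q ^+ 4) j
      / (qpoch (q ^+ 4) (q ^+ 4) j * qpoch (q ^+ 3) (q ^+ 4) j
         * qpoch (q ^+ 5) (q ^+ 4) j) * q ^+ (4 * j))); first by ring.
by rewrite -e1 -e2; ring.
Qed.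

Lemma vwp_step (p a e : K) N m :
  1 - a * p ^+ (2 * m) != 0 ->
  vwp_term p a e N m.+1
  = vwp_term p a e N m
    * ((1 - a * p ^+ (2 * m.+1)) / (1 - a * p ^+ (2 * m))
       * ((1 - a * p ^+ m) * (e - p ^+ m) * (1 - p ^+ (N - m)))
       / ((1 - p ^+ m.+1) * (1 - a * p * e * p ^+ m) * (1 - a * p ^+ N.+1 * p ^+ m))
       * (p ^+ (2 * m) * p * a)).
Proof.
move=> nz; rewrite /vwp_term !qpochS !big_ord_recr /= -exprS.
have -> : p ^+ (m.+1 * m.+1) = p ^+ (m * m) * p ^+ (2 * m) * p.
  by rewrite -exprD -exprSr; congr (_ ^+ _); lia.
rewrite [a ^+ _]exprSr !invfM.
move: (qpoch p p m)^-1 (qpoch (a * p * e) p m)^-1 (qpoch (a * p ^+ N.+1) p m)^-1.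
move: (1 - p ^+ m.+1)^-1 (1 - a * p * e * p ^+ m)^-1 (1 - a * p ^+ N.+1 * p ^+ m)^-1.
move: (1 - a * p ^+ (2 * m)) nz => c nz B1 B2 B3 B4 B5 B6.
by field.
Qed.

Variable N : nat.
Let Q := q ^+ (4 * N).

(* The summand at [k] of the series at [x = q^(4N+2)], where the factor
   [(1 - q) / (1 - q^(4k+1))] has been expanded by [saal_sum]; for fixed [j] the
   terms [k >= j] form a multiple of a [vwp_term] series. *)
Definition watson_term k j : K :=
  (-1) ^+ k * ((1 - q ^+ (8 * k + 2)) / (1 - q ^+ 2))
  * (qpoch (q ^+ 2) (q ^+ 4) k / qpoch (q ^+ 4) (q ^+ 4) k)
  * ((qpoch (Q * q ^+ 4) (q ^+ 4) k * qpoch Q^-1 (q ^+ 4) k)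
     / (qpoch (Q * q ^+ 6) (q ^+ 4) k * qpoch (q ^+ 2 / Q) (q ^+ 4) k))
  * q ^+ (2 * k ^ 2) * saal_term q k j.

Lemma watson_term_step k j : (j <= k)%N ->
  1 - q ^+ (8 * k + 2) != 0 ->
  watson_term k.+1 j
  = watson_term k j
    * (- ((1 - q ^+ (8 * k.+1 + 2)) / (1 - q ^+ (8 * k + 2)))
       * ((1 - q ^+ 2 * q ^+ (4 * k)) / (1 - q ^+ 4 * q ^+ (4 * k)))
       * ((1 - Q * q ^+ 4 * q ^+ (4 * k)) * (1 - Q^-1 * q ^+ (4 * k))
          / ((1 - Q * q ^+ 6 * q ^+ (4 * k)) * (1 - q ^+ 2 / Q * q ^+ (4 * k))))
       * (q ^+ (4 * k) * q ^+ 2)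
       * ((1 - (q ^+ (4 * k.+1))^-1) * (1 - q ^+ (4 * k + 2) * q ^+ (4 * j))
          / ((1 - q ^+ (4 * k + 2)) * (1 - q ^+ (4 * j) / q ^+ (4 * k.+1))))).
Proof.
move=> le_jk; rewrite /watson_term saal_shift // !qpochS -!(exprM q 4).
have -> : q ^+ (2 * k.+1 ^ 2) = q ^+ (2 * k ^ 2) * q ^+ (4 * k) * q ^+ 2.
  by rewrite -!exprD; congr (_ ^+ _); lia.
rewrite [(-1) ^+ _.+1]exprS.
set F := _ / (_ * (1 - q ^+ (4 * j) / _)).
rewrite !invfM.
move: F (qpoch (q ^+ 4) _ _)^-1 (qpoch (Q * q ^+ 6) _ _)^-1 (qpoch (_ / _) _ _)^-1.
move: (1 - _ * _)^-1 (1 - _ * _)^-1 (1 - _ * _)^-1 (1 - q ^+ 2)^-1.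
move: (1 - q ^+ (8 * k + 2)) => c B1 B2 B3 B4 B5 B6 B7 B8 nz.
move: (Q^-1) => iQ; by field.
Qed.

(** Both sides agree at [m = 0] and have the same term ratio, which identifies the 6phi5
    parameters. *)
Lemma watson_term_vwp j m : (j + m <= N)%N ->
  watson_term (j + m) j * (1 - q ^+ (8 * j + 2))
  = watson_term j j
    * vwp_term (q ^+ 4) (q ^+ (8 * j + 2)) (Q * q ^+ (4 * j + 4))^-1 (N - j) m.
Proof.
have q0 i : q ^+ i != 0 by rewrite expf_neq0.
have gen i : (0 < i)%N -> 1 - q ^+ i != 0 by case: i.
elim: m => [|m IH] le_jmN.
  by rewrite addn0 /vwp_term !big_ord0 !qpoch0 muln0 !expr0 !mulr1 invr1 !mulr1.
rewrite vwp_step; last by rewrite -exprM -exprD gen // addnS.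
(* In these four quantities every power of q becomes a monomial, with q^(4N) = XYZ, and the equality
   of ratios becomes a rational identity for [field]. *)
pose X := q ^+ (4 * j); pose Y := q ^+ (4 * m).
pose Z := q ^+ (4 * (N - j - m)); pose b := q ^+ 2.
have X0 : X != 0 := q0 _; have Y0 : Y != 0 := q0 _.
have Z0 : Z != 0 := q0 _; have b0 : b != 0 := q0 _.
have eQ : q ^+ (4 * N) = X * Y * Z by rewrite -!exprD; congr (_ ^+ _); lia.
have e8 : q ^+ (8 * (j + m) + 2) = (X * Y) ^+ 2 * b.
  by rewrite -exprD -exprM -exprD; congr (_ ^+ _); lia.
have e8' : q ^+ (8 * (j + m).+1 + 2) = (X * Y * b * b) ^+ 2 * b.
  by rewrite -!exprD -exprM -exprD; congr (_ ^+ _); lia.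
have e4 : q ^+ (4 * (j + m)) = X * Y by rewrite mulnDr exprD.
have e42 : q ^+ (4 * (j + m) + 2) = X * Y * b by rewrite exprD e4.
have e4' : q ^+ (4 * (j + m).+1) = X * Y * b * b.
  by rewrite -!exprD; congr (_ ^+ _); lia.
have ej : q ^+ (8 * j + 2) = X ^+ 2 * b.
  by rewrite -exprM -exprD; congr (_ ^+ _); lia.
have ej' : q ^+ (4 * j + 4) = X * b * b.
  by rewrite -!exprD; congr (_ ^+ _); lia.
have e6 : q ^+ 6 = b * b * b by rewrite -!exprD.
have ee4 : q ^+ 4 = b * b by rewrite -!exprD.
have f1 : (q ^+ 4) ^+ (2 * m) = Y ^+ 2.
  by rewrite -!exprM; congr (_ ^+ _); lia.
have f2 : (q ^+ 4) ^+ (2 * m.+1) = (Y * b * b) ^+ 2.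
  by rewrite -!exprM -!exprD -exprM; congr (_ ^+ _); lia.
have f3 : (q ^+ 4) ^+ m.+1 = Y * b * b.
  by rewrite -!exprM -!exprD; congr (_ ^+ _); lia.
have f4 : (q ^+ 4) ^+ (N - j).+1 = Y * Z * b * b.
  by rewrite -!exprM -!exprD; congr (_ ^+ _); lia.
have f5 : (q ^+ 4) ^+ (N - j - m) = Z by rewrite -exprM.
have f6 : (q ^+ 4) ^+ m = Y by rewrite -exprM.
have n1 : 1 - (X * Y) ^+ 2 * b != 0 by rewrite -e8 gen ?addnS.
have n2 : 1 - Y * b * b != 0 by rewrite -f3 -exprM gen.
have n3 : 1 - X * Y * b * b != 0 by rewrite -e4' gen.
have n4 : 1 - X * Y * Z * X * Y * b * b * b != 0.
  by rewrite -eQ -!exprD gen ?addnS.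
have n5 : 1 - b / Z != 0.
  rewrite (_ : b / Z = q ^+ (2 + 4 * (j + m)) / q ^+ (4 * N)).
    by apply: sub1_expf_div_neq0; lia.
  by rewrite eQ exprD e4 -/b; field; rewrite X0 Y0 Z0.
have n6 : 1 - X * Y * b != 0 by rewrite -e42 gen ?addnS.
have n7 : 1 - (Y * b * b)^-1 != 0.
  by rewrite -f3 -exprM -[_^-1]mul1r -(expr0 q); apply: sub1_expf_div_neq0.
rewrite [RHS]mulrA -IH; last by apply: leq_trans le_jmN; rewrite addnS.
rewrite [RHS]mulrAC; congr (_ * _); rewrite addnS.
rewrite watson_term_step ?leq_addr ?e8 //; congr (_ * _).
rewrite /Q eQ e8' e4 e42 e4' ej ej' e6 f1 f2 f3 f4 f5 f6 ee4 -/X -/b.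
clearbody X Y Z b; clear -X0 Y0 Z0 b0 n1 n2 n3 n4 n5 n6 n7.
have m1 : 1 - X ^+ 2 * b * Y ^+ 2 != 0.
  by rewrite (_ : X ^+ 2 * b * Y ^+ 2 = (X * Y) ^+ 2 * b) //; ring.
have m3 : 1 - b * b * (X * Y) != 0.
  by rewrite (_ : b * b * (X * Y) = X * Y * b * b) //; ring.
have m4 : 1 - X ^+ 2 * b * (Y * Z * b * b) * Y != 0.
  rewrite (_ : X ^+ 2 * b * (Y * Z * b * b) * Y = X * Y * Z * X * Y * b * b * b) //.
  by ring.
have m5 : Z - b != 0.
  by rewrite (_ : Z - b = Z * (1 - b / Z)) ?mulf_neq0 //; field.
have m7 : Y * b * b - 1 != 0 by rewrite -opprB oppr_eq0.
by field; rewrite X0 Y0 Z0 b0 m1 m3 m4 m5 m7 n2 n6.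
Qed.

(** Reversal of the product by 1 - q^(-s) = - q^(-s) (1 - q^s), with s = 4i + d because c + d =
    4. *)
Lemma qpoch_div_expf c d j : (c + d = 4)%N ->
  qpoch (q ^+ c / q ^+ (4 * j)) (q ^+ 4) j
  = (-1) ^+ j * qpoch (q ^+ d) (q ^+ 4) j / q ^+ (\sum_(i < j) (4 * i + d)).
Proof.
move=> cd4; have q0 i : q ^+ i != 0 by rewrite expf_neq0.
elim: j => [|j IH]; first by rewrite !qpoch0 big_ord0 expr0 !mul1r invr1.
rewrite qpochSl [X in qpoch X](_ : _ = q ^+ c / q ^+ (4 * j)); last first.
  by rewrite mulnS exprD; field; rewrite !q0.
rewrite IH qpochS big_ord_recr [(-1) ^+ _.+1]exprS -(exprM q) -exprD /=.
rewrite (exprD q (\sum_(_ < _) _)) (addnC d).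
have -> : q ^+ (4 * j.+1) = q ^+ c * q ^+ (4 * j + d).
  by rewrite -exprD; congr (_ ^+ _); lia.
by field; rewrite !q0.
Qed.

(** The prefactor of the inner series times its closed form from [vwp_sum], with 1 - q^(8j+2)
    already divided out, gives the summand of the right-hand series. *)
Lemma watson_term_diag j : (j <= N)%N ->
  watson_term j j * qpoch (q ^+ (8 * j + 6)) (q ^+ 4) (N - j)
     / qpoch (q ^+ 2 / Q * q ^+ (4 * j)) (q ^+ 4) (N - j)
  = (-1) ^+ N * q ^+ (2 * N ^ 2) * ((1 - q ^+ (4 * N + 2)) / (1 - q ^+ 2))
    * (qpoch (q ^+ 2) (q ^+ 4) j
       * (qpoch (Q * q ^+ 4) (q ^+ 4) j * qpoch Q^-1 (q ^+ 4) j)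
       / (qpoch (q ^+ 4) (q ^+ 4) j * qpoch (q ^+ 3) (q ^+ 4) j
          * qpoch (q ^+ 5) (q ^+ 4) j) * q ^+ (2 * j)).
Proof.
move=> le_jN; have q0 i : q ^+ i != 0 by rewrite expf_neq0.
have e1 : qpoch (q ^+ 2 / Q) (q ^+ 4) N
  = (-1) ^+ N * qpoch (q ^+ 2) (q ^+ 4) N / q ^+ (2 * N ^ 2).
  rewrite (qpoch_div_expf N (erefl : 2 + 2 = 4)%N); congr (_ / q ^+ _).
  elim: (N) => [|i IH]; first by rewrite big_ord0.
  by rewrite big_ord_recr /= IH; lia.
(* Both sides are (q^2;q^4)_(N+1+j), cut at different places. *)
have e2 : qpoch (q ^+ 2) (q ^+ 4) j * qpoch (q ^+ (4 * j + 2)) (q ^+ 4) j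
   * (1 - q ^+ (8 * j + 2)) * qpoch (q ^+ (8 * j + 6)) (q ^+ 4) (N - j)
  = qpoch (q ^+ 2) (q ^+ 4) N * (1 - q ^+ (4 * N + 2)) * qpoch (Q * q ^+ 6) (q ^+ 4) j.
  rewrite (addnC (4 * j)) exprD (exprM q 4 j) -qpochD addnn.
  have -> : q ^+ (8 * j + 2) = q ^+ 2 * (q ^+ 4) ^+ j.*2.
    by rewrite -exprM -exprD; congr (_ ^+ _); lia.
  rewrite -qpochS.
  have -> : q ^+ (8 * j + 6) = q ^+ 2 * (q ^+ 4) ^+ j.*2.+1.
    by rewrite -exprM -exprD; congr (_ ^+ _); lia.
  rewrite -qpochD (_ : j.*2.+1 + (N - j) = N.+1 + j)%N; last by lia.
  rewrite qpochD qpochS -!exprM /Q -!exprD.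
  by congr (_ * (1 - q ^+ _) * qpoch (q ^+ _) _ _); lia.
have e3 : qpoch (q ^+ 2 / Q) (q ^+ 4) j * qpoch (q ^+ 2 / Q * q ^+ (4 * j)) (q ^+ 4) (N - j)
  = qpoch (q ^+ 2 / Q) (q ^+ 4) N.
  by rewrite (exprM q 4 j) -qpochD subnKC.
have e4 : qpoch (q ^+ (4 * j))^-1 (q ^+ 4) j
  = (-1) ^+ j * qpoch (q ^+ 4) (q ^+ 4) j / q ^+ (2 * j ^ 2 + 2 * j).
  rewrite -[_^-1]mul1r -(expr0 q) (qpoch_div_expf j (erefl : 0 + 4 = 4)%N).
  congr (_ / q ^+ _).
  elim: (j) => [|i IH]; first by rewrite big_ord0.
  by rewrite big_ord_recr /= IH; lia.
have n1 := qpochX_neq0 q_gen 3 4 j.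
have n2 : qpoch (Q * q ^+ 6) (q ^+ 4) j != 0.
  by rewrite -exprD addnS; apply: qpochX_neq0.
have n3 : qpoch (q ^+ 2 / Q) (q ^+ 4) N != 0.
  apply: qpoch_neq0 => i _; rewrite mulrAC -exprM -exprD.
  by apply: sub1_expf_div_neq0; lia.
have n4 := n3.
rewrite -{1}e3 mulf_eq0 negb_or in n4; case/andP: n4 => n4 n6.
have n7 : qpoch (q ^+ 2) (q ^+ 4) N != 0 by apply: qpochX_neq0.
have n8 : 1 - q ^+ 2 != 0 by apply: q_gen.
have n9 := qpochX_neq0 q_gen 2 4 j; have n10 := qpochX_neq0 q_gen 4 4 j.
rewrite /watson_term /saal_term e4.
pose RT := qpoch (q ^+ 2) (q ^+ 4) j
       * (qpoch (Q * q ^+ 4) (q ^+ 4) j * qpoch Q^-1 (q ^+ 4) j)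
       / (qpoch (q ^+ 4) (q ^+ 4) j * qpoch (q ^+ 3) (q ^+ 4) j
          * qpoch (q ^+ 5) (q ^+ 4) j) * q ^+ (2 * j).
rewrite -/RT.
transitivity (qpoch (q ^+ 2) (q ^+ 4) j * qpoch (q ^+ (4 * j + 2)) (q ^+ 4) j
   * (1 - q ^+ (8 * j + 2)) * qpoch (q ^+ (8 * j + 6)) (q ^+ 4) (N - j)
   / (qpoch (q ^+ 2 / Q) (q ^+ 4) j
      * qpoch (q ^+ 2 / Q * q ^+ (4 * j)) (q ^+ 4) (N - j))
   * (RT / ((1 - q ^+ 2) * qpoch (Q * q ^+ 6) (q ^+ 4) j))).
  have -> : q ^+ (2 * j ^ 2 + 2 * j) = q ^+ (2 * j ^ 2) * q ^+ (2 * j) by rewrite exprD.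
  move: n6; set V := qpoch (_ * q ^+ (4 * j)) _ _ => n6.
  have -> : q ^+ (4 * j) = q ^+ (2 * j) * q ^+ (2 * j).
    by rewrite -exprD; congr (_ ^+ _); lia.
  rewrite /RT; move: (q0 (2 * j)%N) (q0 (2 * j ^ 2)%N) n1 n2 n4 n6 n8 n9 n10.
  move: V (qpoch (Q * q ^+ 4) (q ^+ 4) j) (qpoch Q^-1 (q ^+ 4) j).
  move: (qpoch (q ^+ 2 / Q) (q ^+ 4) j) (qpoch (Q * q ^+ 6) (q ^+ 4) j).
  move: (qpoch (q ^+ 2) _ _) (qpoch (q ^+ 3) _ _) (qpoch (q ^+ 4) _ _) (qpoch (q ^+ 5) _ _).
  move: (qpoch _ _ j) (qpoch _ _ (N - j)).
  move: (1 - q ^+ 2) (1 - _) (q ^+ (2 * j)) (q ^+ (2 * j ^ 2)).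
  move=> x1 x2 x3 x4 x5 x6 x7 x8 x9 x10 x11 x12 x13 x14 x15 m1 m2 m3 m4 m5 m6 m7 m8 m9.
  rewrite -signr_odd; case: (odd j); rewrite ?expr0 ?expr1.
    by field; rewrite m1 m2 m3 m4 m5 m6 m7 m8 m9.
  by field; rewrite m1 m2 m3 m4 m5 m6 m7 m8 m9.
rewrite e2 e3 e1; move: RT n2 n7 n8 (q0 (2 * N ^ 2)%N).
move: (qpoch (q ^+ 2) _ _) (qpoch _ _ j) (q ^+ (2 * N ^ 2)) (1 - q ^+ 2) (1 - _).
move=> x1 x2 x3 x4 x5 x6 m1 m2 m3 m4.
rewrite -signr_odd; case: (odd N); rewrite ?expr0 ?expr1.
  by field; rewrite ?oppr_eq0 ?oner_eq0; rewrite m1 m2 m3 m4.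
by field; rewrite ?oppr_eq0 ?oner_eq0; rewrite m1 m2 m3 m4.
Qed.

Lemma terminating_watson :
  \sum_(k < N.+1)
     (-1) ^+ k * ((1 + q ^+ (4 * k + 1)) / (1 + q))
     * (qpoch (q ^+ 2) (q ^+ 4) k / qpoch (q ^+ 4) (q ^+ 4) k)
     * ((qpoch (Q * q ^+ 4) (q ^+ 4) k * qpoch Q^-1 (q ^+ 4) k)
        / (qpoch (Q * q ^+ 6) (q ^+ 4) k * qpoch (q ^+ 2 / Q) (q ^+ 4) k))
     * q ^+ (2 * k ^ 2 + 2 * k)
  = (-1) ^+ N * q ^+ (2 * N ^ 2) * ((1 - q ^+ (4 * N + 2)) / (1 - q ^+ 2))
    * \sum_(j < N.+1) qpoch (q ^+ 2) (q ^+ 4) j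
       * (qpoch (Q * q ^+ 4) (q ^+ 4) j * qpoch Q^-1 (q ^+ 4) j)
       / (qpoch (q ^+ 4) (q ^+ 4) j * qpoch (q ^+ 3) (q ^+ 4) j
          * qpoch (q ^+ 5) (q ^+ 4) j) * q ^+ (2 * j).
Proof.
have q0 i : q ^+ i != 0 by rewrite expf_neq0.
have gen i : (0 < i)%N -> 1 - q ^+ i != 0 by case: i.
(* (1 + q^(4k+1)) / (1 + q) is (1 - q^(8k+2)) / (1 - q^2) times (1 - q) / (1 - q^(4k+1)); the last
   quotient times q^(2k) is the Saalschutz sum over [j]. *)
transitivity (\sum_(k < N.+1) \sum_(j < N.+1 | (j <= k)%N) watson_term k j).
  apply: eq_bigr => k _.
  have -> : \sum_(j < N.+1 | (j <= k)%N) watson_term k j = \sum_(j < k.+1) watson_term k j.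
    by rewrite (big_ord_widen N.+1 (watson_term k)) //; apply: ltn_ord.
  rewrite -mulr_sumr saal_sum //.
  set F := _ / (qpoch _ _ _ * qpoch _ _ _); set G := qpoch _ _ _ / _.
  rewrite (exprD q (2 * k ^ 2)) (_ : q ^+ (8 * k + 2) = q ^+ (4 * k + 1) ^+ 2); last first.
    by rewrite -exprM; congr (_ ^+ _); lia.
  have m1 : 1 - q ^+ (4 * k + 1) != 0 by rewrite gen ?addn1.
  have m2 := gen 1%N isT; have m3 := gen 2%N isT; rewrite expr1 in m2.
  have m4 : 1 + q != 0.
    by apply: contra_neq m3 => h; rewrite -[1](expr1n _ 2) subr_sqr h mulr0.
  have e2 : 1 - q ^+ 2 = (1 - q) * (1 + q) by ring.
  rewrite e2; move: (q ^+ (4 * k + 1)) m1 => x m1.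
  by field; rewrite m1 m2 m4.
rewrite (exchange_big_dep xpredT) //= mulr_sumr; apply: eq_bigr => j _.
have le_jN : (j <= N)%N by rewrite -ltnS.
rewrite -watson_term_diag //.
have m1 : 1 - q ^+ (8 * j + 2) != 0 by rewrite gen ?addnS.
transitivity (\sum_(m < (N - j).+1) watson_term (j + m) j).
  rewrite -(big_mkord (fun k => (j <= k)%N) (watson_term^~ j)).
  rewrite (big_cat_nat (n := j)) ?leqW //= big_nat_cond big1 ?add0r => [|i]; last first.
    by move=> /andP[/andP[_ lt_ij]]; rewrite leqNgt lt_ij.
  rewrite -{1}[nat_of_ord j]add0n big_addn subSn // big_mkord.
  by apply: eq_big => m; rewrite ?leq_addl // addnC.
apply: (mulIf m1); rewrite mulr_suml.
under eq_bigr => m _.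
  rewrite watson_term_vwp; last by move: (ltn_ord m); lia.
  over.
have ea : q ^+ (8 * j + 2) * q ^+ 4 * (Q * q ^+ (4 * j + 4))^-1
          = q ^+ 2 / Q * q ^+ (4 * j).
  rewrite (_ : q ^+ (8 * j + 2) = q ^+ (4 * j) * q ^+ (4 * j) * q ^+ 2); last first.
    by rewrite -!exprD; congr (_ ^+ _); lia.
  rewrite (exprD q (4 * j)); move: (q0 (4 * j)%N) (q0 (4 * N)%N) q_neq0.
  by rewrite -/Q => *; field; apply/and3P.
rewrite -mulr_sumr vwp_sum; rewrite ?ea.
- by rewrite qpochSl -exprD -addnA; ring.
- by move=> i; rewrite -exprM mulnS gen.
- by move=> i; rewrite -exprM -exprD gen // addnAC addnS.
- move=> i; rewrite -exprM -mulrA -exprD mulrAC -exprD.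
  by apply: sub1_expf_div_neq0; lia.
Qed.

End Watson.

Local Notation frac := (@FracField.tofrac {poly rat}).

(** * Orders of rational functions at a polynomial *)

Section Order.
Variable P : {poly rat}.
Implicit Types f g : ratfun.

(* The [P]-adic valuation of [f] is at least [m]. *)
Definition ordge m f := exists a b : {poly rat},
  [/\ b != 0, coprimep b P & f = frac (P ^+ m * a) / frac b].

Lemma ordgeM m k f g : ordge m f -> ordge k g -> ordge (m + k) (f * g).
Proof.
move=> [a [b [b0 cb ->]]] [c [d [d0 cd ->]]].
exists (a * c), (b * d); rewrite mulf_neq0 // coprimepMl cb cd; split=> //.
by rewrite mulf_div -!rmorphM exprD mulrACA.
Qed.

Lemma ordgeD m f g : ordge m f -> ordge m g -> ordge m (f + g).
Proof.
move=> [a [b [b0 cb ->]]] [c [d [d0 cd ->]]].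
exists (a * d + c * b), (b * d); rewrite mulf_neq0 // coprimepMl cb cd; split=> //.
rewrite addf_div ?tofrac_eq0 // -!rmorphM -rmorphD; congr (frac _ / _); ring.
Qed.

Lemma ordgeN m f : ordge m f -> ordge m (- f).
Proof.
move=> [a [b [b0 cb ->]]]; exists (- a), b; split=> //.
by rewrite mulrN rmorphN mulNr.
Qed.

Lemma ordge_weaken m k f : (k <= m)%N -> ordge m f -> ordge k f.
Proof.
move=> /subnKC <- [a [b [b0 cb ->]]]; exists (P ^+ (m - k) * a), b; split=> //.
by rewrite mulrA exprD.
Qed.

Lemma ordge_poly m a : P ^+ m %| a -> ordge m (frac a).
Proof.
move=> /dvdpP [c ->]; exists c, 1; rewrite oner_neq0 coprime1p; split=> //.
by rewrite rmorph1 divr1 mulrC.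
Qed.

Lemma ordge0_poly a : ordge 0 (frac a).
Proof. by apply: ordge_poly; rewrite expr0 dvd1p. Qed.

Lemma ordge0 m : ordge m 0.
Proof. by rewrite -(rmorph0 frac); apply: ordge_poly; rewrite dvdp0. Qed.

Lemma ordge_sum m (I : Type) (r : seq I) (Q : pred I) (F : I -> ratfun) :
  (forall i, Q i -> ordge m (F i)) -> ordge m (\sum_(i <- r | Q i) F i).
Proof. by move=> h; apply: big_ind => //; [apply: ordge0 | exact: ordgeD]. Qed.

Lemma ordgeX m k f : ordge m f -> ordge (m * k) (f ^+ k).
Proof.
move=> hf; elim: k => [|k IH]; last by rewrite exprS mulnS; apply: ordgeM.
by rewrite muln0 expr0 -(rmorph1 frac); apply: ordge0_poly.
Qed.

(** x - y divides x^i - y^i with a regular cofactor, so its order adds to the common order of the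
    coefficients. *)
Lemma ordge_horner_sub k m (G : {poly ratfun}) x y :
  (forall i, ordge m G`_i) -> ordge 0 x -> ordge 0 y -> ordge k (x - y) ->
  ordge (k + m) (G.[x] - G.[y]).
Proof.
move=> hG hx hy hxy; rewrite !horner_coef -sumrB; apply: ordge_sum => i _.
rewrite -mulrBr subrXX addnC; apply: ordgeM => //; rewrite -[k]addn0.
apply: ordgeM => //; apply: ordge_sum => j _; rewrite -[0%N]addn0.
have X0 u e : ordge 0 u -> ordge 0 (u ^+ e).
  by rewrite -[in X in _ -> X](mul0n e); apply: ordgeX.
by apply: ordgeM; apply: X0.
Qed.

End Order.

(** * Evaluation of rational functions at an algebraic number *)

Section Evaluation.
Variable z : algC.
Implicit Types (f g : ratfun) (x y : algC).

Definition evp (a : {poly rat}) : algC := (map_poly ratr a).[z].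

(* [f] is regular at [z] with value [y]. *)
Definition Ev f y := exists a b : {poly rat},
  [/\ evp b != 0, f = frac a / frac b & y = evp a / evp b].

Lemma evpM a b : evp (a * b) = evp a * evp b.
Proof. by rewrite /evp rmorphM hornerM. Qed.

Lemma evpD a b : evp (a + b) = evp a + evp b.
Proof. by rewrite /evp rmorphD hornerD. Qed.

Lemma evp_neq0 b : evp b != 0 -> b != 0.
Proof. by apply: contraNneq => ->; rewrite /evp map_poly0 horner0. Qed.

Lemma evp1 : evp 1 = 1.
Proof. by rewrite /evp rmorph1 hornerC. Qed.

Lemma Ev_poly a : Ev (frac a) (evp a).
Proof. by exists a, 1; rewrite evp1 oner_neq0 rmorph1 !divr1. Qed.

Lemma Ev0 : Ev 0 0.
Proof.
by rewrite -(rmorph0 frac); have := Ev_poly 0; rewrite /evp map_poly0 horner0.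
Qed.

Lemma Ev1 : Ev 1 1.
Proof. by rewrite -(rmorph1 frac) -evp1; apply: Ev_poly. Qed.

Lemma Ev_qvar : Ev qvar z.
Proof.
by have := Ev_poly 'X; rewrite /evp map_polyX hornerX.
Qed.

Lemma EvM f g x y : Ev f x -> Ev g y -> Ev (f * g) (x * y).
Proof.
move=> [a [b [b0 -> ->]]] [c [d [d0 -> ->]]].
by exists (a * c), (b * d); rewrite !evpM mulf_neq0 // !mulf_div -!rmorphM.
Qed.

Lemma EvD f g x y : Ev f x -> Ev g y -> Ev (f + g) (x + y).
Proof.
move=> [a [b [b0 -> ->]]] [c [d [d0 -> ->]]].
exists (a * d + c * b), (b * d); rewrite evpD !evpM mulf_neq0 //; split=> //.
  by rewrite addf_div ?tofrac_eq0 ?evp_neq0 // -!rmorphM -rmorphD.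
by rewrite addf_div.
Qed.

Lemma EvN f x : Ev f x -> Ev (- f) (- x).
Proof.
move=> [a [b [b0 -> ->]]]; exists (- a), b; split=> //.
  by rewrite rmorphN mulNr.
by rewrite /evp rmorphN hornerN mulNr.
Qed.

Lemma EvB f g x y : Ev f x -> Ev g y -> Ev (f - g) (x - y).
Proof. by move=> hf hg; apply: EvD => //; apply: EvN. Qed.

Lemma EvV f x : x != 0 -> Ev f x -> Ev f^-1 x^-1.
Proof.
move=> x0 [a [b [b0 -> e]]]; exists b, a.
by rewrite e !invf_div; move: x0; rewrite e mulf_eq0 negb_or => /andP[].
Qed.

Lemma Ev_div f g x y : y != 0 -> Ev f x -> Ev g y -> Ev (f / g) (x / y).
Proof. by move=> y0 hf hg; apply: EvM => //; apply: EvV. Qed.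

Lemma EvX f x k : Ev f x -> Ev (f ^+ k) (x ^+ k).
Proof.
move=> hf; elim: k => [|k IH]; first exact: Ev1.
by rewrite !exprS; apply: EvM.
Qed.

Lemma Ev_sum (I : Type) (r : seq I) (Q : pred I) (F : I -> ratfun) (G : I -> algC) :
  (forall i, Q i -> Ev (F i) (G i)) ->
  Ev (\sum_(i <- r | Q i) F i) (\sum_(i <- r | Q i) G i).
Proof. by move=> h; apply: (big_ind2 Ev) => //; [apply: Ev0 | move=> *; apply: EvD]. Qed.

Lemma Ev_prod (I : Type) (r : seq I) (Q : pred I) (F : I -> ratfun) (G : I -> algC) :
  (forall i, Q i -> Ev (F i) (G i)) ->
  Ev (\prod_(i <- r | Q i) F i) (\prod_(i <- r | Q i) G i).
Proof. by move=> h; apply: (big_ind2 Ev) => //; [apply: Ev1 | move=> *; apply: EvM]. Qed.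

Lemma Ev_qpoch f g x y m : Ev f x -> Ev g y -> Ev (qpoch f g m) (qpoch x y m).
Proof.
move=> hf hg; apply: Ev_prod => i _.
by apply: EvB; [exact: Ev1 | apply: EvM => //; apply: EvX].
Qed.

Definition EvP (G : {poly ratfun}) (H : {poly algC}) := forall i, Ev G`_i H`_i.

Lemma EvPC f x : Ev f x -> EvP f%:P x%:P.
Proof. by move=> h i; rewrite !coefC; case: eqP => // _; apply: Ev0. Qed.

Lemma EvPX : EvP 'X 'X.
Proof. by move=> i; rewrite !coefX; case: eqP => _; [apply: Ev1 | apply: Ev0]. Qed.

Lemma EvPD F G H J : EvP F H -> EvP G J -> EvP (F + G) (H + J).
Proof. by move=> h1 h2 i; rewrite !coefD; apply: EvD. Qed.

Lemma EvPM F G H J : EvP F H -> EvP G J -> EvP (F * G) (H * J).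
Proof.
by move=> h1 h2 i; rewrite !coefM; apply: Ev_sum => j _; apply: EvM.
Qed.

Lemma EvPB F G H J : EvP F H -> EvP G J -> EvP (F - G) (H - J).
Proof. by move=> h1 h2 i; rewrite !coefB; apply: EvB. Qed.

Lemma EvP_sum (I : Type) (r : seq I) (Q : pred I) F G :
  (forall i : I, Q i -> EvP (F i) (G i)) ->
  EvP (\sum_(i <- r | Q i) F i) (\sum_(i <- r | Q i) G i).
Proof.
by move=> h; apply: (big_ind2 EvP) => // [|*]; [apply/EvPC/Ev0 | apply: EvPD].
Qed.

Lemma EvP_prod (I : Type) (r : seq I) (Q : pred I) F G :
  (forall i : I, Q i -> EvP (F i) (G i)) ->
  EvP (\prod_(i <- r | Q i) F i) (\prod_(i <- r | Q i) G i).
Proof.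
by move=> h; apply: (big_ind2 EvP) => // [|*]; [apply/EvPC/Ev1 | apply: EvPM].
Qed.

Variable P : {poly rat}.
Hypothesis P_neq0 : P != 0.
Hypothesis P_min : forall a, (P %| a) = (evp a == 0).

(** The gcd does not vanish at [z] because [b] does not, so the quotient of [P] by it does; then [P]
    divides this quotient, and degrees force the gcd to be constant. *)
Lemma coprimep_evp b : evp b != 0 -> coprimep b P.
Proof.
move=> b0; have: evp (P %/ gcdp b P * gcdp b P) == 0.
  by rewrite divpK ?dvdp_gcdr // -P_min.
rewrite evpM mulf_eq0.
have g0 : evp (gcdp b P) != 0.
  apply: contra b0; rewrite -[X in _ -> evp X == 0](divpK (dvdp_gcdl b P)) evpM.
  by move=> /eqP->; rewrite mulr0.
rewrite (negPf g0) orbF -P_min => /dvdp_leq; rewrite /coprimep.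
have gn0 : gcdp b P != 0 by apply: evp_neq0.
rewrite dvdp_div_eq0 ?dvdp_gcdr // P_neq0 size_divp // => /(_ isT).
have := dvdp_leq P_neq0 (dvdp_gcdr b P); move: gn0 P_neq0; rewrite -!size_poly_gt0.
by move=> *; apply/eqP; lia.
Qed.

Lemma Ev_ordge0 f y : Ev f y -> ordge P 0 f.
Proof.
move=> [a [b [b0 -> _]]]; exists a, b; rewrite evp_neq0 // coprimep_evp //; split=> //.
by rewrite expr0 mul1r.
Qed.

Lemma Ev_ordge1 f : Ev f 0 -> ordge P 1 f.
Proof.
move=> [a [b [b0 -> /esym/eqP]]]; rewrite mulf_eq0 invr_eq0 (negPf b0) orbF -P_min.
move=> /dvdpP[c ->]; exists c, b; rewrite evp_neq0 // coprimep_evp //; split=> //.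
by rewrite expr1 [c * P]mulrC.
Qed.

End Evaluation.

(** Each order condition supplies a fraction whose denominator is prime to one modulus. The reduced
    denominator divides it by Gauss's lemma, so a single reduced fraction serves both moduli. *)
Lemma congr_ratfun_ordge (P1 P2 : {poly rat}) m1 m2 (f g : ratfun) :
  P1 != 0 -> P2 != 0 -> coprimep P1 P2 ->
  ordge P1 m1 (f - g) -> ordge P2 m2 (f - g) ->
  congr_ratfun (P1 ^+ m1 * P2 ^+ m2) f g.
Proof.
move=> n1 n2 cop [a1 [b1 [b10 cb1 e1]]] [a2 [b2 [b20 cb2 e2]]].
pose h := gcdp (P1 ^+ m1 * a1) b1.
have h0 : h != 0 by rewrite gcdp_eq0 negb_and b10 orbT.
pose a := (P1 ^+ m1 * a1) %/ h; pose b := b1 %/ h.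
have ea : P1 ^+ m1 * a1 = a * h by rewrite divpK // dvdp_gcdl.
have eb : b1 = b * h by rewrite divpK // dvdp_gcdr.
have b0 : b != 0 by apply: contraNneq b10; rewrite eb => ->; rewrite mul0r.
have cab : coprimep a b by apply: coprimep_div_gcd; rewrite b10 orbT.
have fab : f - g = frac a / frac b.
  by rewrite e1 ea {1}eb !rmorphM -mulf_div divff ?mulr1 ?tofrac_eq0.
have key (P : {poly rat}) m c d : d != 0 -> coprimep d P ->
    f - g = frac (P ^+ m * c) / frac d -> (P ^+ m %| a) && coprimep b P.
  move=> d0 cd; rewrite fab => /eqP.
  rewrite eqr_div ?tofrac_eq0 // -!rmorphM tofrac_eq => /eqP e.
  have dvd_bd : b %| d.
    by rewrite -(Gauss_dvdpr d (_ : coprimep b a)) 1?coprimep_sym // e dvdp_mull.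
  rewrite (coprimep_dvdr dvd_bd cd) andbT.
  rewrite -(Gauss_dvdpl a (coprimep_expl m (_ : coprimep P d))) 1?coprimep_sym //.
  by rewrite e -mulrA dvdp_mulr.
have /andP[d1 c1] := key _ _ _ _ b10 cb1 e1.
have /andP[d2 c2] := key _ _ _ _ b20 cb2 e2.
exists a, b; split=> //.
  by rewrite Gauss_dvdp ?d1 // coprimep_expl // coprimep_expr.
by rewrite coprimepMr !coprimep_expr.
Qed.

(** * Products that switch factors at an index *)

Section SplitProduct.
Variables (R : comNzRingType) (N : nat).

(** Division-free form of the product of [A i / B i] over [i < k], scaled by all the [B i]; it makes
    sense over polynomials in t as well. *)
Definition split_prod (A B : nat -> R) k : R :=
  \prod_(i < N) (if (i < k)%N then A i else B i).

Lemma split_prod_rev A B k : (k <= N)%N ->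
  split_prod A B (N - k)
  = split_prod (fun i => B (N - i.+1)%N) (fun i => A (N - i.+1)%N) k.
Proof.
move=> le_kN; rewrite /split_prod (reindex_inj rev_ord_inj) /=.
apply: eq_bigr => i _; have := ltn_ord i.
by case: ifP; case: ifP => //; lia.
Qed.

Lemma split_prodM A B C D k :
  split_prod A B k * split_prod C D k
  = split_prod (fun i => A i * C i) (fun i => B i * D i) k.
Proof. by rewrite -big_split; apply: eq_bigr => i _; case: ifP. Qed.

Lemma eq_split_prod A B C D k :
  (forall i, (i < N)%N -> A i = C i) -> (forall i, (i < N)%N -> B i = D i) ->
  split_prod A B k = split_prod C D k.
Proof.
by move=> eA eB; apply: eq_bigr => i _; case: ifP => _; [apply: eA | apply: eB].
Qed.

Lemma split_prodN A B k :
  split_prod (fun i => - A i) (fun i => - B i) k = (-1) ^+ N * split_prod A B k.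
Proof.
transitivity (\prod_(i < N) (-1 * (if (i < k)%N then A i else B i))).
  by apply: eq_bigr => i _; case: ifP; rewrite mulN1r.
by rewrite big_split /= big_const_ord iter_mulr_1.
Qed.

Lemma split_prodS A B k : (k < N)%N ->
  split_prod A B k.+1 * B k = split_prod A B k * A k.
Proof.
move=> lt_kN; pose o := Ordinal lt_kN.
rewrite /split_prod (bigD1 o) //= [in RHS](bigD1 o) //= ltnS leqnn ltnn.
rewrite -mulrA [RHS]mulrC; congr (_ * _); rewrite mulrC; congr (_ * _).
by apply: eq_bigr => i; rewrite -val_eqE /= ltnS leq_eqVlt => /negPf->.
Qed.

Lemma split_prod0 A B : split_prod A B 0 = \prod_(i < N) B i.
Proof. by []. Qed.

Lemma split_prodE A B k : (k <= N)%N ->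
  split_prod A B k * \prod_(i < k) B i = \prod_(i < k) A i * \prod_(i < N) B i.
Proof.
elim: k => [|k IH] le_kN; first by rewrite split_prod0 !big_ord0 mulr1 mul1r.
rewrite !big_ord_recr /= [RHS]mulrAC -IH ?(ltnW le_kN) //.
by rewrite [\prod_(i < k) B i * _]mulrC mulrA split_prodS // mulrAC.
Qed.

End SplitProduct.

(** * The reflection k -> N - k when z^(2N+1) = -1 *)

Section Antisymmetry.
Variables (R : comNzRingType) (N : nat) (z t : R).

(* With [t = x + 1/x] this is [(1 - x z^m) (1 - z^m / x)]; at [t = 2] it is
   [(1 - z^m)^2]. *)
Definition wfac m : R := 1 + z ^+ (2 * m) - z ^+ m * t.

(* The deformation of [c_q k] in which two of the three factors
   [(q^2;q^4)_k / (q^4;q^4)_k] become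
   [(x q^2, q^2/x; q^4)_k / (x q^4, q^4/x; q^4)_k], multiplied by the common
   denominator of the terms [k <= N]. *)
Definition cdef_term k : R :=
  (-1) ^+ k * (1 + z ^+ (4 * k + 1)) * z ^+ (2 * k ^ 2 + 2 * k)
  * split_prod N (fun i => 1 - z ^+ (4 * i + 2)) (fun i => 1 - z ^+ (4 * i + 4)) k
  * split_prod N (fun i => wfac (4 * i + 2)) (fun i => wfac (4 * i + 4)) k.

Hypothesis zn : z ^+ (2 * N + 1) = -1.

Lemma root_double_order : z ^+ (4 * N + 2) = 1.
Proof.
have -> : (4 * N + 2 = (2 * N + 1) * 2)%N by lia.
by rewrite exprM zn sqrrN expr1n.
Qed.

(** In a ring without division, z^((4N+1)m) serves as the inverse of z^m. *)
Lemma root_mul_inj m : injective ( *%R (z ^+ m)).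
Proof.
move=> x y /(congr1 ( *%R (z ^+ ((4 * N + 1) * m)))).
have cancel u : z ^+ ((4 * N + 1) * m) * (z ^+ m * u) = u.
  rewrite mulrA -exprD (_ : _ + m = (4 * N + 2) * m)%N; last by lia.
  by rewrite exprM root_double_order expr1n mul1r.
by rewrite !cancel.
Qed.

Let A i := 1 - z ^+ (4 * i + 2).
Let B i := 1 - z ^+ (4 * i + 4).
Let Z := split_prod N (fun i => z ^+ (4 * i + 2)) (fun i => z ^+ (4 * i + 4)).

Lemma sub1_reflect4 i : (i < N)%N -> z ^+ (4 * i + 4) * A (N - i.+1) = - B i.
Proof.
move=> lt; rewrite /A /B mulrBr mulr1 -exprD.
by rewrite (_ : 4 * i + 4 + _ = 4 * N + 2)%N ?root_double_order ?opprB //; lia.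
Qed.

Lemma sub1_reflect2 i : (i < N)%N -> z ^+ (4 * i + 2) * B (N - i.+1) = - A i.
Proof.
move=> lt; rewrite /A /B mulrBr mulr1 -exprD.
by rewrite (_ : 4 * i + 2 + _ = 4 * N + 2)%N ?root_double_order ?opprB //; lia.
Qed.

Lemma wfac_reflect m l : (m + l = 4 * N + 2)%N -> z ^+ m ^+ 2 * wfac l = wfac m.
Proof.
move=> e; rewrite /wfac -exprM mulrBr mulrDr mulr1 -exprD mulrA -exprD.
rewrite (_ : m * 2 + 2 * l = (4 * N + 2) * 2)%N; last by lia.
rewrite (_ : m * 2 + l = 4 * N + 2 + m)%N; last by lia.
rewrite (exprM z (4 * N + 2)) (exprD z (4 * N + 2)) root_double_order.
by rewrite expr1n mul1r mulnC [1 + _]addrC.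
Qed.

(** Moving the cut by one replaces z^(4i+4) by z^(4i+2), a loss that z^(2k) compensates. *)
Lemma split_root_shift k : (k <= N)%N -> Z k * z ^+ (2 * k) = z ^+ (2 * N * N.+1).
Proof.
move=> le_kN.
have -> : z ^+ (2 * N * N.+1) = \prod_(i < N) z ^+ (4 * i + 4).
  elim: (N) => [|m IH]; first by rewrite big_ord0.
  by rewrite big_ord_recr /= -IH -exprD; congr (_ ^+ _); lia.
have -> : z ^+ (2 * k) = split_prod N (fun=> z ^+ 2) (fun=> 1) k.
  rewrite /split_prod -big_mkcond /= prodr_const exprM; congr (_ ^+ _).
  rewrite -sum1_card -(big_ord_widen N (fun=> 1%N)) // sum1_card card_ord //.
rewrite split_prodM; apply: eq_bigr => i _; case: ifP => _; last by rewrite mulr1.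
by rewrite -exprD -addnA.
Qed.

Let M := split_prod N A B.
Let W := split_prod N (fun i => wfac (4 * i + 2)) (fun i => wfac (4 * i + 4)).

Lemma split_qpoch_reflect k : (k <= N)%N -> Z k * M (N - k) = (-1) ^+ N * M k.
Proof.
move=> le_kN; rewrite /M split_prod_rev // split_prodM -split_prodN.
by apply: eq_split_prod => i lt; [apply: sub1_reflect2 | apply: sub1_reflect4].
Qed.

Lemma split_wfac_reflect k : (k <= N)%N -> Z k ^+ 2 * W (N - k) = W k.
Proof.
move=> le_kN; rewrite /W split_prod_rev // expr2 !split_prodM.
by apply: eq_split_prod => i lt; rewrite -expr2; apply: wfac_reflect; lia.
Qed.

(** Reflection divides [M] by [Z k] up to the sign (-1)^N, and [W] by its square; (-1)^N is absorbed
    by (-1)^(N-k), and the surviving minus sign comes from the powers of z. *)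
Lemma cdef_term_reflect k : (k <= N)%N -> cdef_term (N - k) = - cdef_term k.
Proof.
move=> le_kN; have eM := split_qpoch_reflect le_kN; have eW := split_wfac_reflect le_kN.
have eZ := split_root_shift le_kN.
apply: (@root_mul_inj (6 * N * N.+1 + (4 * k + 1))).
have e6 : z ^+ (6 * N * N.+1) = Z k ^+ 3 * z ^+ (6 * k).
  rewrite (_ : 6 * N * N.+1 = 2 * N * N.+1 * 3)%N; last by lia.
  rewrite exprM -eZ exprMn -exprM; congr (_ * z ^+ _); lia.
rewrite /cdef_term -/M -/W -/A -/B.
have eN : (-1) ^+ (N - k) * (-1) ^+ N = (-1) ^+ k :> R.
  rewrite -exprD -signr_odd oddD oddB //.
  by rewrite addbAC addbb addFb signr_odd.
have eMW : Z k ^+ 3 * (M (N - k) * W (N - k)) = (-1) ^+ N * (M k * W k).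
  transitivity (Z k * M (N - k) * (Z k ^+ 2 * W (N - k))); first by ring.
  by rewrite eM eW mulrA.
have sq1 : (-1) ^+ N * (-1) ^+ N = 1 :> R by rewrite -expr2 sqrr_sign.
have eE : z ^+ (6 * k) * z ^+ (2 * (N - k) ^ 2 + 2 * (N - k))
      = - (z ^+ (6 * N * N.+1 + (4 * k + 1)) * z ^+ (2 * k ^ 2 + 2 * k)).
  rewrite -!exprD -mulN1r.
  (* -1 is written as an odd power of z^(2N+1), and then 1 as a power of z^(4N+2), so that the two
     exponents agree as natural numbers. *)
  have -> : (-1 : R) = z ^+ ((2 * N + 1) * (2 * N + 1 + 2 * k)).
    rewrite exprM zn (_ : _ + _ = (N + k).*2.+1)%N; last by lia.
    by rewrite -signr_odd /= odd_double.
  rewrite -exprD -[LHS]mul1r.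
  have -> : (1 : R) = z ^+ ((4 * N + 2) * (2 * N + 1 + 2 * k)).
    by rewrite exprM root_double_order expr1n.
  rewrite -exprD; congr (_ ^+ _); move: le_kN => /subnKC {eM eW eZ e6 eN eMW sq1}.
  by move: (N - k)%N => l <-; nia.
have eF : z ^+ (4 * k + 1) * (1 + z ^+ (4 * (N - k) + 1)) = 1 + z ^+ (4 * k + 1).
  by rewrite mulrDr mulr1 -exprD addrC (_ : _ + _ = 4 * N + 2)%N ?root_double_order //; lia.
transitivity ((-1) ^+ (N - k)
   * (z ^+ (4 * k + 1) * (1 + z ^+ (4 * (N - k) + 1)))
   * (z ^+ (6 * k) * z ^+ (2 * (N - k) ^ 2 + 2 * (N - k)))
   * (Z k ^+ 3 * (M (N - k) * W (N - k)))).
  by rewrite exprD e6; ring.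
by rewrite eMW eF eE -eN; ring.
Qed.

(** Terms [k] and [N - k] cancel, but a middle term is its own partner; hence the doubled sum. *)
Lemma sum_cdef_term : (forall x : R, x + x = 0 -> x = 0) ->
  \sum_(k < N.+1) cdef_term k = 0.
Proof.
move=> h2; apply: h2.
rewrite {1}(reindex_inj rev_ord_inj) -big_split big1 //= => k _.
by rewrite subSS cdef_term_reflect ?addNr // -ltnS.
Qed.

(** [M j * A j] is also [M j.+1 * B j], so its reflection pairs [j] with [N - j.+1]; this product is
    the denominator met in [ctail]. *)
Lemma split_qpoch_reflectS j : (j < N)%N ->
  Z j.+1 * z ^+ (4 * j + 4) * (M (N - j.+1) * A (N - j.+1))
  = - (-1) ^+ N * (M j * A j).
Proof.
move=> lt_jN; rewrite mulrACA split_qpoch_reflect // sub1_reflect4 //.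
by rewrite mulNr -[M j * A j]split_prodS // mulrN mulrA.
Qed.

End Antisymmetry.

(** * The coefficients and their tails over a field *)

Section Coefficients.
Variables (K : fieldType) (N : nat) (q : K).

(** [c_q] over an arbitrary field, to be taken both at [qvar] and at a root in [algC]. *)
Definition cgen k : K :=
  (-1) ^+ k
  * ((1 + q ^+ (4 * k + 1)) * qpoch (q ^+ 2) (q ^+ 4) k ^+ 3
     / ((1 + q) * qpoch (q ^+ 4) (q ^+ 4) k ^+ 3))
  * q ^+ (2 * k ^ 2 + 2 * k).

(* [cgen (N + j.+1)] with the vanishing factors [1 - q^(4N+2)] removed. *)
Definition ctail j : K :=
  let k := (N + j.+1)%N in
  (-1) ^+ k
  * ((1 + q ^+ (4 * k + 1))
     * (qpoch (q ^+ 2) (q ^+ 4) N * qpoch (q ^+ (4 * N + 6)) (q ^+ 4) j) ^+ 3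
     / ((1 + q) * qpoch (q ^+ 4) (q ^+ 4) k ^+ 3))
  * q ^+ (2 * k ^ 2 + 2 * k).

Lemma cgen_ctail j : cgen (N + j.+1) = (1 - q ^+ (4 * N + 2)) ^+ 3 * ctail j.
Proof.
rewrite /cgen /ctail; have -> : qpoch (q ^+ 2) (q ^+ 4) (N + j.+1)
  = (1 - q ^+ (4 * N + 2))
    * (qpoch (q ^+ 2) (q ^+ 4) N * qpoch (q ^+ (4 * N + 6)) (q ^+ 4) j).
  rewrite qpochD qpochSl -exprM -!exprD mulrCA addnC.
  by rewrite (_ : 4 * N + 2 + 4 = 4 * N + 6)%N // -addnA.
by rewrite exprMn; ring.
Qed.

Lemma qpochE c d k : qpoch (q ^+ c) (q ^+ d) k = \prod_(i < k) (1 - q ^+ (d * i + c)).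
Proof. by apply: eq_bigr => i _; rewrite -exprM -exprD addnC. Qed.

Lemma wfac2 m : wfac q 2 m = (1 - q ^+ m) ^+ 2.
Proof. by rewrite /wfac mulnC exprM; ring. Qed.

Lemma cdef_term2 k :
  cdef_term N q 2 k = (-1) ^+ k * (1 + q ^+ (4 * k + 1)) * q ^+ (2 * k ^ 2 + 2 * k)
  * split_prod N (fun i => 1 - q ^+ (4 * i + 2)) (fun i => 1 - q ^+ (4 * i + 4)) k ^+ 3.
Proof.
rewrite /cdef_term [X in _ * _ * X](_ : _ = split_prod N
  (fun i => 1 - q ^+ (4 * i + 2)) (fun i => 1 - q ^+ (4 * i + 4)) k ^+ 2).
  by ring.
by rewrite expr2 split_prodM; apply: eq_split_prod => i _; rewrite wfac2 expr2.
Qed.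

Hypothesis q1 : 1 + q != 0.
Hypothesis q4 : qpoch (q ^+ 4) (q ^+ 4) N != 0.

Lemma cgen_cdef_term k : (k <= N)%N ->
  cgen k = cdef_term N q 2 k / ((1 + q) * qpoch (q ^+ 4) (q ^+ 4) N ^+ 3).
Proof.
move=> le_kN.
have := split_prodE (fun i => 1 - q ^+ (4 * i + 2))
  (fun i => 1 - q ^+ (4 * i + 4)) le_kN.
rewrite -!qpochE cdef_term2 /cgen.
have q4k : qpoch (q ^+ 4) (q ^+ 4) k != 0.
  by move: q4; rewrite -(subnKC le_kN) qpochD mulf_eq0 negb_or => /andP[].
move: (split_prod _ _ _ _) => x e.
have -> : x = qpoch (q ^+ 2) (q ^+ 4) k * qpoch (q ^+ 4) (q ^+ 4) N
  / qpoch (q ^+ 4) (q ^+ 4) k.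
  by rewrite -e mulfK.
by field; rewrite q1 q4 q4k.
Qed.

Hypothesis qn : q ^+ (2 * N + 1) = -1.

Lemma cgen_reflect k : (k <= N)%N -> cgen (N - k) = - cgen k.
Proof.
by move=> le; rewrite !cgen_cdef_term ?leq_subr // cdef_term_reflect // mulNr.
Qed.

Hypothesis q2 : qpoch (q ^+ 2) (q ^+ 4) N != 0.

(** As q^(4N+2) = 1, the factorials beyond index N wrap around, and [ctail] reduces to the cube of a
    quotient with denominator [M j * (1 - q ^+ (4 * j + 2))], whose reflection is known. *)
Lemma ctail_reflect j : (j < N)%N -> ctail (N - j.+1) = - ctail j.
Proof.
move=> lt_jN.
pose M := split_prod N (fun i => 1 - q ^+ (4 * i + 2)) (fun i => 1 - q ^+ (4 * i + 4)).
have q2n := root_double_order qn.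
have rho i : (i < N)%N ->
   qpoch (q ^+ 2) (q ^+ 4) N * qpoch (q ^+ (4 * N + 6)) (q ^+ 4) i
     / qpoch (q ^+ 4) (q ^+ 4) (N + i.+1)
   = qpoch (q ^+ 2) (q ^+ 4) N / (M i * (1 - q ^+ (4 * i + 2))).
  move=> lt_iN.
  have e1 : q ^+ (4 * N + 6) = q ^+ 4.
    by rewrite (_ : 4 * N + 6 = 4 * N + 2 + 4)%N ?(exprD q (4 * N + 2)) ?q2n ?mul1r //; lia.
  have e2 : q ^+ 4 * (q ^+ 4) ^+ N = q ^+ 2.
    rewrite -exprM -exprD (_ : 4 + 4 * N = 4 * N + 2 + 2)%N; last by lia.
    by rewrite (exprD q (4 * N + 2)) q2n mul1r.
  rewrite e1 qpochD e2 qpochS.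
  have := split_prodE (fun i => 1 - q ^+ (4 * i + 2))
    (fun i => 1 - q ^+ (4 * i + 4)) (ltnW lt_iN).
  rewrite -/M -!qpochE => e.
  have nz m : (m <= N)%N -> qpoch (q ^+ 4) (q ^+ 4) m != 0.
    by move=> le; move: q4; rewrite -(subnKC le) qpochD mulf_eq0 negb_or => /andP[].
  have n1 := nz _ (ltnW lt_iN); have n2 := q4.
  have : qpoch (q ^+ 2) (q ^+ 4) i.+1 != 0.
    by move: q2; rewrite -(subnKC lt_iN) qpochD mulf_eq0 negb_or => /andP[].
  rewrite qpochS mulf_eq0 negb_or => /andP[n3 n4].
  have -> : M i = qpoch (q ^+ 2) (q ^+ 4) i * qpoch (q ^+ 4) (q ^+ 4) N
    / qpoch (q ^+ 4) (q ^+ 4) i.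
    by rewrite -e mulfK.
  have e3 : q ^+ (4 * i + 2) = q ^+ 2 * q ^+ 4 ^+ i by rewrite -exprM -exprD addnC.
  by rewrite e3; field; rewrite n1 n2 n3 n4.
pose r i := qpoch (q ^+ 2) (q ^+ 4) N / (M i * (1 - q ^+ (4 * i + 2))).
have ctailE i : (i < N)%N -> ctail i
  = (-1) ^+ (N + i.+1) * (1 + q ^+ (4 * (N + i.+1) + 1)) / (1 + q)
   * r i ^+ 3 * q ^+ (2 * (N + i.+1) ^ 2 + 2 * (N + i.+1)).
  move=> lt_iN; rewrite /r -rho // /ctail expr_div_n.
  by rewrite invfM; ring.
rewrite !ctailE //; last by lia.
have q0 : q != 0.
  by apply: contra_eq_neq qn => ->; rewrite addn1 expr0n eq_sym oppr_eq0 oner_eq0.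
have sign2 m : (-1) ^+ m * (-1) ^+ m = 1 :> K by rewrite -expr2 sqrr_sign.
have er : r (N - j.+1)%N = - ((-1) ^+ N * q ^+ (2 * N * N.+1 + 2 * j.+1) * r j).
  have := split_qpoch_reflectS qn lt_jN.
  rewrite /r -/M; have -> : q ^+ (4 * j + 4) = q ^+ (2 * j.+1) * q ^+ (2 * j.+1).
    by rewrite -exprD; congr (_ ^+ _); lia.
  rewrite [_ * (q ^+ _ * q ^+ _)]mulrA split_root_shift // -exprD => e.
  apply: (mulfI (expf_neq0 (2 * N * N.+1 + 2 * j.+1) q0)).
  have {e} -> : M (N - j.+1)%N * (1 - q ^+ (4 * (N - j.+1) + 2))
    = - (q ^+ (2 * N * N.+1 + 2 * j.+1))^-1 * (-1) ^+ N * (M j * (1 - q ^+ (4 * j + 2))).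
    apply: (mulfI (expf_neq0 (2 * N * N.+1 + 2 * j.+1) q0)); rewrite e.
    by rewrite !mulrA mulrN divff ?expf_neq0 //; ring.

  rewrite !invfM invrN invrK invr_sign; ring.
rewrite er; have lk : (j.+1 + (N - j.+1) = N)%N by rewrite subnKC.
move: lk (r j); set l := (N - j.+1)%N; set k := j.+1 => lk x.
have eu : q ^+ (4 * (N + l.+1) + 1) * q ^+ (4 * (N + k) + 1) = 1.
  rewrite -exprD (_ : _ + _ = (4 * N + 2) * 3)%N; last by lia.
  by rewrite exprM q2n expr1n.
have eu' : 1 + q ^+ (4 * (N + l.+1) + 1)
           = q ^+ (4 * (N + l.+1) + 1) * (1 + q ^+ (4 * (N + k) + 1)).
  by rewrite mulrDr eu mulr1 addrC.
have ee : q ^+ (4 * (N + l.+1) + 1) * q ^+ (2 * N * N.+1 + 2 * k) ^+ 3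
    * q ^+ (2 * (N + l.+1) ^ 2 + 2 * (N + l.+1))
    = - q ^+ (2 * (N + k) ^ 2 + 2 * (N + k)).
  rewrite -mulN1r.
  have -> : (-1 : K) = q ^+ ((2 * N + 1) * (6 * l + 9)).
    rewrite exprM qn (_ : 6 * l + 9 = (3 * l + 4).*2.+1)%N; last by lia.
    by rewrite -signr_odd /= odd_double.
  rewrite -exprM -!exprD; congr (_ ^+ _).
  by rewrite -lk; nia.
have es : (-1) ^+ (N + l.+1) * (-1) ^+ N = - (-1) ^+ (N + k) :> K.
  rewrite -exprD -[RHS]mulN1r -exprS -[LHS]signr_odd -[RHS]signr_odd; congr (_ ^+ _).
  by rewrite -lk; lia.
transitivity (- ((-1) ^+ (N + l.+1) * (-1) ^+ N) * ((-1) ^+ N * (-1) ^+ N)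
   * (1 + q ^+ (4 * (N + k) + 1)) / (1 + q) * x ^+ 3
   * (q ^+ (4 * (N + l.+1) + 1) * q ^+ (2 * N * N.+1 + 2 * k) ^+ 3
    * q ^+ (2 * (N + l.+1) ^ 2 + 2 * (N + l.+1)))).
  by rewrite eu'; ring.
by rewrite ee es sign2; ring.
Qed.

Lemma sum_cgen : (2 : K) != 0 -> \sum_(k < N.+1) cgen k = 0.
Proof.
move=> n2; have h2 (x : K) : x + x = 0 -> x = 0.
  by move/eqP; rewrite -mulr2n -mulr_natl mulf_eq0 (negPf n2) => /eqP.
have := sum_cdef_term 2 qn h2.
rewrite (eq_bigr (fun k : 'I_N.+1 => cgen k * ((1 + q) * qpoch (q ^+ 4) (q ^+ 4) N ^+ 3))).
  move/eqP; rewrite -mulr_suml mulf_eq0.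
  by rewrite (negPf (mulf_neq0 q1 (expf_neq0 3 q4))) orbF => /eqP.
by move=> k _; rewrite cgen_cdef_term ?divfK ?mulf_neq0 ?expf_neq0 // -ltnS.
Qed.

(* Reversing both indices exchanges the triangle [i + j < N] with its complement
   in the rectangle [i <= N], [j < N], over which the sum vanishes. *)
Lemma cross_sum_eq0 : (2 : K) != 0 ->
  \sum_(j < N) ctail j * \sum_(i < N - j) cgen i = 0.
Proof.
move=> n2; set S := LHS.
have S1 : S = \sum_(j < N) ctail j * (\sum_(k < N.+1) cgen k - \sum_(i < N - j) cgen i).
  rewrite {1}/S (reindex_inj rev_ord_inj) /=; apply: eq_bigr => j _.
  have lt := ltn_ord j; rewrite ctail_reflect // mulNr -mulrN; congr (_ * _).
  rewrite -[X in X - _](big_mkord xpredT cgen) (@big_cat_nat _ _ _ (N - j)) ?leq_subr //=;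
    last by lia.
  rewrite big_mkord addrAC subrr add0r big_nat_rev /= -(big_mkord xpredT cgen).
  rewrite -sumrN -{1}[(N - j)%N]add0n big_addn big_mkord.
  rewrite (_ : N - (N - j.+1) = j.+1)%N; last by lia.
  rewrite (_ : N.+1 - (N - j) = j.+1)%N; last by lia.
  rewrite big_mkord; apply: eq_bigr => i _; have := ltn_ord i => lt_i.
  by rewrite -cgen_reflect; [congr cgen|]; lia.
have : S + S = 0.
  rewrite {2}S1 /S -big_split big1 //= => j _.
  by rewrite sum_cgen // sub0r mulrN addrN.
by move/eqP; rewrite -mulr2n -mulr_natl mulf_eq0 (negPf n2) => /eqP.
Qed.

End Coefficients.

(** * Decomposition of a truncated Cauchy product *)

Section DoubleSum.
Variables (R : comNzRingType) (f : nat -> R) (N : nat).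

(** The triangle i + j <= 2N is the square i, j <= N together with two mirror-image triangles in
    which one index exceeds N. *)
Lemma cauchy_square :
  \sum_(0 <= k < 2 * N + 1) \sum_(0 <= j < k.+1) f j * f (k - j)
  = (\sum_(k < N.+1) f k) ^+ 2
    + 2 * \sum_(j < N) f (N + j.+1) * \sum_(i < N - j) f i.
Proof.
pose F m := \sum_(0 <= i < m) f i.
transitivity (\sum_(0 <= j < 2 * N + 1) f j * F (2 * N + 1 - j)%N).
  elim: (2 * N + 1)%N => [|m IH]; first by rewrite !big_geq.
  rewrite big_nat_recr //= IH big_nat_recr //= [in RHS]big_nat_recr //=.
  rewrite subnn subSnn /F big_nat1 addrA; congr (_ + _).
  rewrite -big_split /=; apply: eq_big_nat => i /andP[_ lt_im].
  by rewrite subSn ?(ltnW lt_im) // big_nat_recr //= mulrDr.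
rewrite (@big_cat_nat _ _ _ N.+1) //=; last by lia.
have e1 : \sum_(N.+1 <= j < 2 * N + 1) f j * F (2 * N + 1 - j)%N
   = \sum_(j < N) f (N + j.+1) * \sum_(i < N - j) f i.
  rewrite -{1}[N.+1]add0n big_addn (_ : 2 * N + 1 - N.+1 = N)%N; last by lia.
  rewrite big_mkord; apply: eq_bigr => j _; have := ltn_ord j => lt_j.
  rewrite /F (_ : 2 * N + 1 - _ = N - j)%N ?big_mkord; last by lia.
  by congr (f _ * _); lia.
have e2 : \sum_(0 <= j < N.+1) f j * F (2 * N + 1 - j)%N
   = (\sum_(k < N.+1) f k) ^+ 2 + \sum_(j < N) f (N + j.+1) * \sum_(i < N - j) f i.
  (* The same triangle read by its small index [i]: the large one runs from [N.+1] to
     [2 * N - i]. *)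
  have -> : \sum_(j < N) f (N + j.+1) * \sum_(i < N - j) f i
     = \sum_(0 <= i < N.+1) f i * \sum_(N.+1 <= j < 2 * N + 1 - i) f j.
    transitivity (\sum_(j < N) \sum_(i < N.+1 | (i + j < N)%N) f (N + j.+1) * f i).
      apply: eq_bigr => j _; rewrite -mulr_sumr; congr (_ * _).
      rewrite (big_ord_widen_cond N.+1 xpredT f) ?leqW ?leq_subr //=.
      by apply: eq_bigl => i; rewrite ltn_subRL addnC.
    rewrite (exchange_big_dep xpredT) //= big_mkord; apply: eq_bigr => i _.
    move: (nat_of_ord i) (ltn_ord i) => {}i lt_i.
    rewrite mulr_sumr -{1}[N.+1]add0n big_addn.
    rewrite (_ : 2 * N + 1 - i - N.+1 = N - i)%N; last by lia.
    rewrite big_mkord (big_ord_widen_cond N xpredT (fun j => f i * f (j + N.+1)))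
      ?leq_subr //=.
    apply: eq_big => j; first by rewrite ltn_subRL.
    by move=> _; rewrite mulrC addnC addSnnS.
  rewrite expr2 -(big_mkord xpredT f) mulr_suml -big_split /=.
  apply: eq_big_nat => i /andP[_ le_iN]; rewrite -mulrDr; congr (_ * _).
  by rewrite /F -big_cat_nat //; lia.
by rewrite e1 e2; ring.
Qed.

End DoubleSum.

Lemma add1_neq0 (K : fieldType) (q : K) : 1 - q ^+ 2 != 0 -> 1 + q != 0.
Proof.
by apply: contra_neq => h; rewrite -[1](expr1n _ 2) subr_sqr h mulr0.
Qed.

(** * The deformed identity as a polynomial in t *)

Section Interpolation.
Variables (K : fieldType) (q : K) (N : nat).

(** Only one of the three factors (q^2;q^4)_j is kept; the other two carry the parameter and
    reappear as products of [wfac]. *)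
Definition rcoef j : K :=
  qpoch (q ^+ 2) (q ^+ 4) j
  / (qpoch (q ^+ 4) (q ^+ 4) j * qpoch (q ^+ 3) (q ^+ 4) j
     * qpoch (q ^+ 5) (q ^+ 4) j).

(* Difference of the two sides of the deformed single-sum identity, times the
   common denominator of the left-hand side. *)
Definition diff_poly (y : nat -> K) : {poly K} :=
  \sum_(k < N.+1) cdef_term N q%:P 'X k
  - \sum_(j < N.+1)
      ((1 + q) * qpoch (q ^+ 4) (q ^+ 4) N * ((-1) ^+ N * q ^+ (2 * N ^ 2))
       * y j * q ^+ (2 * j))%:P
      * (\prod_(i < j) wfac q%:P 'X (4 * i + 2))
      * \prod_(i < N) wfac q%:P 'X (4 * i + 4).

Lemma horner_wfac t m : (wfac q%:P 'X m).[t] = wfac q t m.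
Proof. by rewrite /wfac !hornerE. Qed.

Lemma horner_split_prod (A B : nat -> {poly K}) t k :
  (split_prod N A B k).[t] = split_prod N (fun i => (A i).[t]) (fun i => (B i).[t]) k.
Proof. by rewrite horner_prod; apply: eq_bigr => i _; case: ifP. Qed.

Lemma horner_cdef_term t k : (cdef_term N q%:P 'X k).[t] = cdef_term N q t k.
Proof.
rewrite /cdef_term !hornerM !horner_split_prod.
congr (_ * _ * _ * _ * _).
- by rewrite !hornerE.
- by rewrite !hornerE.
- by rewrite !hornerE.
- by apply: eq_split_prod => i _; rewrite !hornerE.
- by apply: eq_split_prod => i _; rewrite horner_wfac.
Qed.

Lemma horner_diff_poly y t :
  (diff_poly y).[t]
  = \sum_(k < N.+1) cdef_term N q t k
    - (1 + q) * qpoch (q ^+ 4) (q ^+ 4) N * ((-1) ^+ N * q ^+ (2 * N ^ 2))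
      * (\sum_(j < N.+1) y j * q ^+ (2 * j) * \prod_(i < j) wfac q t (4 * i + 2))
      * \prod_(i < N) wfac q t (4 * i + 4).
Proof.
rewrite /diff_poly hornerD hornerN !horner_sum; congr (_ - _).
  by apply: eq_bigr => k _; rewrite horner_cdef_term.
rewrite mulr_sumr mulr_suml; apply: eq_bigr => j _.
rewrite !hornerM hornerC !horner_prod.
under eq_bigr do rewrite horner_wfac.
under [X in _ * X]eq_bigr do rewrite horner_wfac.
by rewrite !mulrA.
Qed.

Hypothesis q_neq0 : q != 0.
Hypothesis q_gen : forall m, 1 - q ^+ m.+1 != 0.

(** t = x + 1/x at x = q^(4N+2), where (q^2/x;q^4)_k is (q^(-4N);q^4)_k and terminates the
    series. *)
Let t0 := q ^+ (4 * N + 2) + (q ^+ (4 * N + 2))^-1.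
Let y j := qint (2 * N + 1) (q ^+ 2) * rcoef j.

Lemma qint_geom : qint (2 * N + 1) (q ^+ 2) = (1 - q ^+ (4 * N + 2)) / (1 - q ^+ 2).
Proof.
have n2 : 1 - q ^+ 2 != 0 by apply: q_gen.
apply: (mulIf n2); rewrite divfK // mulrC /qint -opprB mulNr -subrX1 opprB.
by rewrite -exprM; congr (1 - _ ^+ _); lia.
Qed.

Lemma wfac_t0 m :
  wfac q t0 m = (1 - q ^+ (4 * N + 2) * q ^+ m) * (1 - q ^+ m / q ^+ (4 * N + 2)).
Proof.
rewrite /wfac /t0 mulnC exprM; have : q ^+ (4 * N + 2) != 0 by rewrite expf_neq0.
by move: (q ^+ _) (q ^+ m) => x u x0; field.
Qed.

Lemma prod_wfac_t0_2 k : \prod_(i < k) wfac q t0 (4 * i + 2)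
  = qpoch (q ^+ (4 * N) * q ^+ 4) (q ^+ 4) k * qpoch (q ^+ (4 * N))^-1 (q ^+ 4) k.
Proof.
rewrite /qpoch -big_split; apply: eq_bigr => i _ /=.
rewrite wfac_t0 -!exprM (exprD q (4 * N)) (exprD q (4 * i)).
have : q ^+ (4 * N) != 0 by rewrite expf_neq0.
by move: (q ^+ (4 * N)) (q ^+ (4 * i)) => x u x0; field; rewrite x0 q_neq0.
Qed.

Lemma prod_wfac_t0_4 k : \prod_(i < k) wfac q t0 (4 * i + 4)
  = qpoch (q ^+ (4 * N) * q ^+ 6) (q ^+ 4) k * qpoch (q ^+ 2 / q ^+ (4 * N)) (q ^+ 4) k.
Proof.
rewrite /qpoch -big_split; apply: eq_bigr => i _ /=.
rewrite wfac_t0 -!exprM (exprD q (4 * N)) (exprD q (4 * i)).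
have : q ^+ (4 * N) != 0 by rewrite expf_neq0.
by move: (q ^+ (4 * N)) (q ^+ (4 * i)) => x u x0; field; rewrite x0 q_neq0.
Qed.

(** This is [terminating_watson] with denominators cleared. *)
Lemma diff_poly_t0 : (diff_poly y).[t0] = 0.
Proof.
rewrite horner_diff_poly.
have q1 := add1_neq0 (q_gen 1).
have q4 k : qpoch (q ^+ 4) (q ^+ 4) k != 0 by apply: (qpochX_neq0 q_gen 3).
have V0 k : \prod_(i < k) wfac q t0 (4 * i + 4) != 0.
  apply/prodf_neq0 => i _; rewrite wfac_t0 mulf_neq0 //.
    by rewrite -exprD addnS; apply: q_gen.
  by apply: sub1_expf_div_neq0 => //; lia.
have e1 k : (k <= N)%N -> cdef_term N q t0 k
  = (1 + q) * qpoch (q ^+ 4) (q ^+ 4) N * \prod_(i < N) wfac q t0 (4 * i + 4)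
    * ((-1) ^+ k * ((1 + q ^+ (4 * k + 1)) / (1 + q))
     * (qpoch (q ^+ 2) (q ^+ 4) k / qpoch (q ^+ 4) (q ^+ 4) k)
     * (\prod_(i < k) wfac q t0 (4 * i + 2) / \prod_(i < k) wfac q t0 (4 * i + 4))
     * q ^+ (2 * k ^ 2 + 2 * k)).
  move=> le_kN; rewrite /cdef_term.
  have := split_prodE (fun i => wfac q t0 (4 * i + 2))
    (fun i => wfac q t0 (4 * i + 4)) le_kN.
  have := split_prodE (fun i => 1 - q ^+ (4 * i + 2))
    (fun i => 1 - q ^+ (4 * i + 4)) le_kN.
  rewrite -!qpochE; move: (split_prod _ _ _ _) (split_prod _ _ _ _) => w m em ew.
  have -> : m = qpoch (q ^+ 2) (q ^+ 4) k * qpoch (q ^+ 4) (q ^+ 4) N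
    / qpoch (q ^+ 4) (q ^+ 4) k.
    by rewrite -em mulfK.
  have -> : w = \prod_(i < k) wfac q t0 (4 * i + 2) * \prod_(i < N) wfac q t0 (4 * i + 4)
               / \prod_(i < k) wfac q t0 (4 * i + 4).
    by rewrite -ew mulfK.
  move: (V0 k) (q4 k); move: (\prod_(i < k) _) (\prod_(i < k) _) (\prod_(i < N) _).
  move: (qpoch _ _ k) (qpoch _ _ k) (qpoch _ _ N) ((-1) ^+ k)
    (q ^+ (2 * k ^ 2 + 2 * k)) (1 + q ^+ _).
  by move=> x1 x2 x3 x4 x5 x6 x7 x8 x9 n1 n2; field; rewrite q1 n1 n2.
rewrite (eq_bigr _ (fun (k : 'I_N.+1) _ => e1 k _)) => [|k]; last by rewrite -ltnS.
rewrite -mulr_sumr.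
have -> : \sum_(j < N.+1) y j * q ^+ (2 * j) * \prod_(i < j) wfac q t0 (4 * i + 2)
  = (1 - q ^+ (4 * N + 2)) / (1 - q ^+ 2) * \sum_(j < N.+1) qpoch (q ^+ 2) (q ^+ 4) j
       * (\prod_(i < j) wfac q t0 (4 * i + 2))
       / (qpoch (q ^+ 4) (q ^+ 4) j * qpoch (q ^+ 3) (q ^+ 4) j
          * qpoch (q ^+ 5) (q ^+ 4) j) * q ^+ (2 * j).
  by rewrite -qint_geom mulr_sumr; apply: eq_bigr => j _; rewrite /y /rcoef; ring.
have := terminating_watson q_neq0 q_gen N.
under eq_bigr do rewrite -prod_wfac_t0_2 -prod_wfac_t0_4.
under [in RHS]eq_bigr do rewrite -prod_wfac_t0_2.
by move=> ->; ring.
Qed.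

Lemma diff_poly_2 :
  (diff_poly y).[2]
  = (1 + q) * qpoch (q ^+ 4) (q ^+ 4) N ^+ 3
    * (\sum_(k < N.+1) cgen q k
       - (-1) ^+ N * q ^+ (2 * N ^ 2) * qint (2 * N + 1) (q ^+ 2)
         * \sum_(j < N.+1) qpoch (q ^+ 2) (q ^+ 4) j ^+ 3
            / qpochs [:: q ^+ 4; q ^+ 3; q ^+ 5] (q ^+ 4) j * q ^+ (2 * j)).
Proof.
rewrite horner_diff_poly.
have q1 := add1_neq0 (q_gen 1).
have q4 k : qpoch (q ^+ 4) (q ^+ 4) k != 0 by apply: (qpochX_neq0 q_gen 3).
have -> : \prod_(i < N) wfac q 2 (4 * i + 4) = qpoch (q ^+ 4) (q ^+ 4) N ^+ 2.
  by rewrite qpochE -prodrXl; apply: eq_bigr => i _; rewrite wfac2.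
rewrite (eq_bigr (fun k : 'I_N.+1 =>
  (1 + q) * qpoch (q ^+ 4) (q ^+ 4) N ^+ 3 * cgen q k)); last first.
  move=> k _; rewrite (cgen_cdef_term q1 (q4 N)); last by rewrite -ltnS.
  by rewrite mulrC divfK // mulf_neq0 // expf_neq0.
have -> : \sum_(j < N.+1) y j * q ^+ (2 * j) * \prod_(i < j) wfac q 2 (4 * i + 2)
  = qint (2 * N + 1) (q ^+ 2) * \sum_(j < N.+1) qpoch (q ^+ 2) (q ^+ 4) j ^+ 3
            / qpochs [:: q ^+ 4; q ^+ 3; q ^+ 5] (q ^+ 4) j * q ^+ (2 * j).
  rewrite mulr_sumr; apply: eq_bigr => j _.
  rewrite (eq_bigr (fun i : 'I_j => (1 - q ^+ (4 * i + 2)) ^+ 2)) => [|i _];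
    last by rewrite wfac2.
  rewrite prodrXl -qpochE /y /rcoef /qpochs !big_cons big_nil.
  by rewrite !invfM invr1; ring.
by rewrite -mulr_sumr; ring.
Qed.

(** Subtracting the zero value at [t0] turns the undeformed difference into a polynomial increment,
    the shape bounded by [ordge_horner_sub]. *)
Lemma diff_poly_increment :
  \sum_(k < N.+1) cgen q k
  - (-1) ^+ N * q ^+ (2 * N ^ 2) * qint (2 * N + 1) (q ^+ 2)
    * (\sum_(j < N.+1) qpoch (q ^+ 2) (q ^+ 4) j ^+ 3
         / qpochs [:: q ^+ 4; q ^+ 3; q ^+ 5] (q ^+ 4) j * q ^+ (2 * j))
  = ((1 + q) * qpoch (q ^+ 4) (q ^+ 4) N ^+ 3)^-1
    * ((diff_poly y).[2] - (diff_poly y).[t0]).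
Proof.
rewrite diff_poly_t0 subr0 diff_poly_2 mulKf //.
apply: mulf_neq0; first exact: add1_neq0 (q_gen 1).
by apply: expf_neq0; apply: (qpochX_neq0 q_gen 3).
Qed.

(** x + 1/x has a critical point at x = 1 with value 2, hence the double zero. *)
Lemma two_sub_t0 : 2 - t0 = (1 - q ^+ (4 * N + 2)) ^+ 2 * - (q ^+ (4 * N + 2))^-1.
Proof.
rewrite /t0; have := expf_neq0 (4 * N + 2) q_neq0.
by move: (q ^+ _) => u u0; field.
Qed.

End Interpolation.

(** * The point [qvar] and cancellation in the right-hand coefficients *)

Local Ltac ev := repeat lazymatch goal with
  | |- Ev _ qvar _ => exact: Ev_qvar
  | |- Ev _ 1 _ => exact: Ev1
  | |- Ev _ (qpoch _ _ _) _ => apply: Ev_qpoch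
  | |- Ev _ (_ ^+ _) _ => apply: EvX
  | |- Ev _ (_ * _) _ => apply: EvM
  | |- Ev _ (_^-1) _ => apply: EvV
  | |- Ev _ (- _) _ => apply: EvN
  | |- Ev _ (_ + _) _ => apply: EvD
  end.

Lemma qvar_neq0 : qvar != 0.
Proof. by rewrite tofrac_eq0 polyX_eq0. Qed.

Lemma qvar_gen m : 1 - qvar ^+ m.+1 != 0.
Proof.
rewrite /qvar -tofracXn -tofrac1 -tofracB tofrac_eq0.
apply/eqP => /(congr1 (horner^~ 0)); rewrite !hornerE expr0n /= subr0.
by move/eqP; rewrite oner_eq0.
Qed.

(** The exponents 3, 7, 11, ... and 5, 9, 13, ... interleave to the odd numbers, which locates the
    factor 1 - q^n. *)
Lemma qpoch_odd (K : fieldType) (q : K) j :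
  qpoch (q ^+ 3) (q ^+ 4) j * qpoch (q ^+ 5) (q ^+ 4) j
  = \prod_(m < 2 * j) (1 - q ^+ (2 * m + 3)).
Proof.
elim: j => [|j IH]; first by rewrite !qpoch0 big_ord0 mulr1.
rewrite !qpochS mulrACA IH mulnS !big_ord_recr /= -!exprM -!exprD !mulrA.
by congr (_ * (1 - q ^+ _) * (1 - q ^+ _)); lia.
Qed.

Section YCoef.
Variables (K : fieldType) (q : K) (N : nat).
Let n := (2 * N + 1)%N.

(* [qint n (q^2) * rcoef j] with its only factor [1 - q^n], that of index [N.-1]
   in [qpoch_odd], cancelled. *)
Definition ycoef j : K :=
  (1 + q ^+ n) * qpoch (q ^+ 2) (q ^+ 4) j
  * (if (N <= 2 * j)%N then 1 else 1 - q ^+ n)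
  / ((1 - q ^+ 2) * qpoch (q ^+ 4) (q ^+ 4) j
     * \prod_(i < 2 * j | (i : nat) != N.-1) (1 - q ^+ (2 * i + 3))).

Hypothesis N_gt0 : (0 < N)%N.
Hypothesis q_neq0 : q != 0.
Hypothesis q_gen : forall m, 1 - q ^+ m.+1 != 0.

Lemma ycoefE j : (j <= N)%N ->
  qint n (q ^+ 2) * rcoef q j = ycoef j.
Proof.
move=> le_jN; rewrite (qint_geom N q_neq0 q_gen) /rcoef /ycoef.
rewrite -(mulrA (qpoch (q ^+ 4) _ j)) qpoch_odd.
have -> : 1 - q ^+ (4 * N + 2) = (1 + q ^+ n) * (1 - q ^+ n).
  rewrite mulrC -subr_sqr expr1n -exprM; congr (1 - _ ^+ _); rewrite /n; lia.
have q2 := q_gen 1; have q4 := qpochX_neq0 q_gen 3 4 j.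
have R0 : \prod_(i < 2 * j | (i : nat) != N.-1) (1 - q ^+ (2 * i + 3)) != 0.
  by apply/prodf_neq0 => i _; rewrite addnS q_gen.
have qn : 1 - q ^+ n != 0 by rewrite /n addn1 q_gen.
(* As N > 0, the index [N.-1], whose exponent is [n], lies below [2 * j] exactly when
   [N <= 2 * j]. *)
case: ifP => hN.
  have lt : (N.-1 < 2 * j)%N by lia.
  rewrite (bigD1 (Ordinal lt)) //= (_ : 2 * N.-1 + 3 = n)%N; last by rewrite /n; lia.
  under eq_bigl => i do rewrite -val_eqE /=.
  move: (\prod_(i < _ | _) _) R0 (1 - q ^+ n) qn q2 q4 => R R0 u u0.
  by move: (1 - q ^+ 2) (qpoch (q ^+ 4) _ _) => v w v0 w0; field; rewrite v0 w0 u0 R0.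
rewrite [X in _ * (_ / (_ * X))](_ : _ =
  \prod_(i < 2 * j | (i : nat) != N.-1) (1 - q ^+ (2 * i + 3))).
  move: (\prod_(i < _ | _) _) R0 q2 q4 => R R0.
  by move: (1 - q ^+ 2) (qpoch (q ^+ 4) _ _) => v w v0 w0; field; rewrite v0 w0 R0.
by apply: eq_bigl => i; have := ltn_ord i; lia.
Qed.

End YCoef.

(** * Orders at one cyclotomic factor *)

Section Local.
Variables (z : algC) (P : {poly rat}) (N : nat).
Let n := (2 * N + 1)%N.
Hypothesis N_gt0 : (0 < N)%N.
Hypothesis z2_prim : n.-primitive_root (z ^+ 2).
Hypothesis P_neq0 : P != 0.
Hypothesis P_min : forall a, (P %| a) = (evp z a == 0).
(* The root [z = - zeta] of [Phi_n(-q)] gains one order ([m = 1]) over the root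
   [z = zeta] of [Phi_n(q)] ([m = 0]). *)
Variable m : nat.
Hypothesis m_cond : (m = 0%N) \/ (m = 1%N /\ z ^+ n = -1).

Lemma Ev_ordge f y : Ev z f y -> (z ^+ n = -1 -> y = 0) -> ordge P m f.
Proof.
case: m_cond => [-> hf _|[-> zn] hf /(_ zn) y0]; first exact: Ev_ordge0 hf.
by apply: Ev_ordge1 => //; rewrite -y0.
Qed.

Lemma sub1_root_expr_neq0 k : ~~ (n %| k)%N -> 1 - z ^+ k != 0.
Proof.
apply: contra; rewrite subr_eq0 eq_sym => /eqP zk.
by rewrite (prim_order_dvd z2_prim) exprAC zk expr1n.
Qed.

Lemma root_neq0 : z != 0.
Proof.
have := prim_expr_order z2_prim; apply: contra_eq_neq => ->.
by rewrite !expr0n /n addn1 eq_sym oner_eq0.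
Qed.

Lemma root_add1_neq0 : 1 + z != 0.
Proof.
have : 1 - z ^+ 2 != 0 by apply: sub1_root_expr_neq0; apply/negP => /dvdn_leq; lia.
by apply: contra_neq => h; rewrite -[1](expr1n _ 2) subr_sqr h mulr0.
Qed.

Lemma order_ndvd_mul4 k : (k < n)%N -> (0 < k)%N -> ~~ (n %| 4 * k)%N.
Proof.
move=> lt_kn k0; rewrite Gauss_dvdr; first by rewrite gtnNdvd.
by rewrite (coprimeXr 2 (_ : coprime n 2)) // coprimen2 /n addn1 /= mul2n odd_double.
Qed.

Lemma root_qpoch4_neq0 k : (k < n)%N -> qpoch (z ^+ 4) (z ^+ 4) k != 0.
Proof.
move=> lt_kn; apply: qpoch_neq0 => i lt_ik; rewrite -exprM -exprD -mulnS.
by apply: sub1_root_expr_neq0; apply: order_ndvd_mul4 => //; apply: leq_ltn_trans lt_kn.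
Qed.

Lemma root_qpoch2_neq0 : qpoch (z ^+ 2) (z ^+ 4) N != 0.
Proof.
apply: qpoch_neq0 => i lt_iN; rewrite -exprM -exprD.
(* A multiple of [n] strictly between 0 and 2n is [n], which is odd, while 4i + 2 is even. *)
by apply: sub1_root_expr_neq0; apply/negP => /dvdnP[[|[|c]]]; rewrite /n; nia.
Qed.

Lemma Ev_cgen k : (k < n)%N -> Ev z (cgen qvar k) (cgen z k).
Proof.
move=> lt_kn; rewrite /cgen; ev.
by rewrite mulf_neq0 ?root_add1_neq0 // expf_neq0 // root_qpoch4_neq0.
Qed.

Lemma Ev_ctail j : (j < N)%N -> Ev z (ctail N qvar j) (ctail N z j).
Proof.
move=> lt_jN; rewrite /ctail; ev.
by rewrite mulf_neq0 ?root_add1_neq0 // expf_neq0 // root_qpoch4_neq0 // /n; lia.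
Qed.

Lemma root_expr_double : z ^+ (4 * N + 2) = 1.
Proof.
have -> : (4 * N + 2 = 2 * n)%N by rewrite /n; lia.
by rewrite exprM (prim_expr_order z2_prim).
Qed.

Lemma ordge_sub1 : ordge P 1 (1 - qvar ^+ (4 * N + 2)).
Proof.
by apply: (Ev_ordge1 P_neq0 P_min); rewrite -(subrr (1 : algC)) -{2}root_expr_double; ev.
Qed.

Lemma Ev_ycoef j : (j <= N)%N -> Ev z (ycoef qvar N j) (ycoef z N j).
Proof.
move=> le_jN; rewrite /ycoef; apply: Ev_div.
- have n2 : 1 - z ^+ 2 != 0.
    by apply: sub1_root_expr_neq0; apply/negP => /dvdn_leq; rewrite /n; lia.
  rewrite !mulf_neq0 // ?root_qpoch4_neq0 //; first by rewrite /n; lia.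
  apply/prodf_neq0 => i ne_i; apply: sub1_root_expr_neq0.
  (* Since 2i + 3 < 2n, the only possible multiple is [n] itself, at the excluded index [N.-1]. *)
  have lt_i := ltn_ord i; apply/negP => /dvdnP[[|[|c]]]; rewrite /n; nia.
- by case: ifP => _; ev.
- by ev; apply: Ev_prod => i _; ev.
Qed.

Lemma Ev_cdef_term k : EvP z (cdef_term N qvar%:P 'X k) (cdef_term N z%:P 'X k).
Proof.
have EvPexp F H e : EvP z F H -> EvP z (F ^+ e) (H ^+ e).
  by move=> h; elim: e => [|e IH]; [apply/EvPC/Ev1 | rewrite !exprS; apply: EvPM].
have EvPq e : EvP z (qvar%:P ^+ e) (z%:P ^+ e) by apply/EvPexp/EvPC/Ev_qvar.
have EvP1 : EvP z 1 1 by apply/EvPC/Ev1.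
have EvPw i : EvP z (wfac qvar%:P 'X i) (wfac z%:P 'X i).
  by apply: EvPB; [apply: EvPD | apply: EvPM => //; apply: EvPX].
have EvPs A B C D : (forall i, EvP z (A i) (C i)) -> (forall i, EvP z (B i) (D i)) ->
    EvP z (split_prod N A B k) (split_prod N C D k).
  by move=> h1 h2; apply: EvP_prod => i _; case: ifP.
apply: EvPM; last by apply: EvPs.
apply: EvPM; last by apply: EvPs => i; apply: EvPB.
apply: EvPM => //; apply: EvPM; last by apply: EvPD.
by apply: EvPexp; rewrite -!polyCN; apply/EvPC/EvN/Ev1.
Qed.

Lemma Ev_diff_poly :
  EvP z (diff_poly qvar N (fun j => qint n (qvar ^+ 2) * rcoef qvar j))
    (diff_poly z N (ycoef z N)).
Proof.
have EvPw i : EvP z (wfac qvar%:P 'X i) (wfac z%:P 'X i).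
  rewrite /wfac -!polyC_exp; apply: EvPB.
    by apply: EvPD; apply: EvPC; [apply: Ev1 | ev].
  by apply: EvPM; [apply: EvPC; ev | apply: EvPX].
apply: EvPB; first by apply: EvP_sum => k _; apply: Ev_cdef_term.
apply: EvP_sum => j _; apply: EvPM; last by apply: EvP_prod => i _.
apply: EvPM; last by apply: EvP_prod => i _.
have le_jN : (j <= N)%N by rewrite -ltnS.
rewrite (ycoefE N_gt0 qvar_neq0 qvar_gen le_jN); apply: EvPC.
apply: EvM; last by ev.
by apply: EvM; [ev | apply: Ev_ycoef].
Qed.

(** When z^n = -1 the factor 1 + z^n kills every [ycoef], and antisymmetry over [{poly algC}] makes
    the remaining sum vanish identically in t. *)
Lemma ordge_diff_poly i :
  ordge P m (diff_poly qvar N (fun j => qint n (qvar ^+ 2) * rcoef qvar j))`_i.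
Proof.
apply: Ev_ordge (Ev_diff_poly i) _; rewrite /n => zn.
rewrite /diff_poly [X in _ - X]big1 ?subr0 => [|j _]; last first.
  by rewrite /ycoef zn subrr !mul0r mulr0 mul0r polyC0 !mul0r.
rewrite sum_cdef_term ?coef0 //.
  by rewrite -polyC_exp zn polyCN.
move=> x /eqP; rewrite -mulr2n -mulr_natl mulf_eq0 -polyC_natr polyC_eq0.
by rewrite Num.Theory.pnatr_eq0 => /eqP.
Qed.

Let S := \sum_(k < N.+1) cgen qvar k.
Let R := (-1) ^+ N * qvar ^+ (2 * N ^ 2) * qint n (qvar ^+ 2)
         * \sum_(j < N.+1) qpoch (qvar ^+ 2) (qvar ^+ 4) j ^+ 3
            / qpochs [:: qvar ^+ 4; qvar ^+ 3; qvar ^+ 5] (qvar ^+ 4) j * qvar ^+ (2 * j).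

Lemma two_neq0 : (2 : algC) != 0.
Proof. by rewrite Num.Theory.pnatr_eq0. Qed.

Lemma Ev2 : Ev z 2 2.
Proof. by rewrite -[2]/(1 + 1); apply: EvD; apply: Ev1. Qed.

Lemma ordge_S : ordge P m S.
Proof.
have EvS : Ev z S (\sum_(k < N.+1) cgen z k).
  by apply: Ev_sum => k _; apply: Ev_cgen; have := ltn_ord k; rewrite /n; lia.
apply: Ev_ordge EvS _ => zn; apply: sum_cgen => //; first exact: root_add1_neq0.
  by apply: root_qpoch4_neq0; rewrite /n; lia.
exact: two_neq0.
Qed.

(** Order 2 comes from 2 - t0 and order [m] from the coefficients of [diff_poly]; the scalar in
    front is regular. *)
Lemma ordge_SR : ordge P (2 + m) (S - R).
Proof.
have c0 : Ev z ((1 + qvar) * qpoch (qvar ^+ 4) (qvar ^+ 4) N ^+ 3)^-1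
   ((1 + z) * qpoch (z ^+ 4) (z ^+ 4) N ^+ 3)^-1.
  ev; rewrite mulf_neq0 ?root_add1_neq0 // expf_neq0 // root_qpoch4_neq0 // /n; lia.
have zQ : z ^+ (4 * N + 2) != 0 by rewrite expf_neq0 // root_neq0.
rewrite /S /R (diff_poly_increment N qvar_neq0 qvar_gen).
rewrite -[(2 + m)%N]add0n; apply: ordgeM; first exact: Ev_ordge0 c0.
have Et0 : Ev z (qvar ^+ (4 * N + 2) + (qvar ^+ (4 * N + 2))^-1)
   (z ^+ (4 * N + 2) + (z ^+ (4 * N + 2))^-1) by ev.
apply: ordge_horner_sub; first exact: ordge_diff_poly.
- exact: Ev_ordge0 Ev2.
- exact: Ev_ordge0 Et0.
rewrite (two_sub_t0 N qvar_neq0).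
rewrite -[2%N]addn0; apply: ordgeM; first by rewrite -[2%N]mul1n; apply/ordgeX/ordge_sub1.
have EvI : Ev z (- (qvar ^+ (4 * N + 2))^-1) (- (z ^+ (4 * N + 2))^-1) by ev.
exact: Ev_ordge0 EvI.
Qed.

Lemma ordge_cross :
  ordge P m (\sum_(j < N) ctail N qvar j * \sum_(i < N - j) cgen qvar i).
Proof.
have EvC : Ev z (\sum_(j < N) ctail N qvar j * \sum_(i < N - j) cgen qvar i)
  (\sum_(j < N) ctail N z j * \sum_(i < N - j) cgen z i).
  apply: Ev_sum => j _; apply: EvM; first exact: Ev_ctail.
  by apply: Ev_sum => i _; apply: Ev_cgen; have := ltn_ord i; rewrite /n; lia.
apply: Ev_ordge EvC _ => zn; apply: cross_sum_eq0 => //; first exact: root_add1_neq0.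
- by apply: root_qpoch4_neq0; rewrite /n; lia.
- exact: root_qpoch2_neq0.
- exact: two_neq0.
Qed.

(** In (S - R)(S + R) the factors have orders 2 + m and m; the cross term has order 3 + m, which
    suffices as m <= 1. *)
Lemma ordge_main :
  ordge P (2 + 2 * m)
    (\sum_(0 <= k < 2 * N + 1) \sum_(0 <= j < k.+1) cgen qvar j * cgen qvar (k - j)
     - R ^+ 2).
Proof.
rewrite cauchy_square -/S.
under eq_bigr do rewrite cgen_ctail -mulrA.
rewrite -mulr_sumr.
set T := \sum_(j < N) _; set u := 1 - _.
have -> : S ^+ 2 + 2 * (u ^+ 3 * T) - R ^+ 2 = (S - R) * (S + R) + u ^+ 3 * (T * 2).
  ring.
have m_le1 : (m <= 1)%N by case: m_cond => [->|[->]].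
apply: ordgeD; last first.
  apply: (@ordge_weaken _ (3 + (m + 0))); first by lia.
  apply: ordgeM; first by rewrite -[3%N]mul1n; apply/ordgeX/ordge_sub1.
  by apply: ordgeM; [apply: ordge_cross | apply: Ev_ordge0 Ev2].
rewrite (_ : 2 + 2 * m = (2 + m) + m)%N; last by lia.
apply: ordgeM; first exact: ordge_SR.
(* The order of S + R follows from those of S and S - R. *)
rewrite (_ : S + R = S + S - (S - R)); last by ring.
apply: ordgeD; first by apply: ordgeD; apply: ordge_S.
by apply: ordgeN; apply: ordge_weaken ordge_SR; lia.
Qed.

End Local.

(** * Cyclotomic polynomials and the substitution q -> -q *)

Section Cyclotomic.
Variables (n : nat) (w : algC).
Hypothesis w_prim : n.-primitive_root w.

Lemma map_cyclotomic_rat : map_poly ratr (cyclotomic_rat n) = cyclotomic w n.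
Proof.
rewrite -(Cintr_Cyclotomic w_prim) -map_poly_comp.
by apply: eq_map_poly => x; rewrite /= ratr_int.
Qed.

(** The cyclotomic polynomial is the minimal polynomial of [w] over the rationals. *)
Lemma cyclotomic_rat_min a : (cyclotomic_rat n %| a) = (evp w a == 0).
Proof.
have [p [e _ h]] := minCpolyP w.
have -> : cyclotomic_rat n = p.
  apply: (map_poly_inj (ratr : {rmorphism rat -> algC})).
  by rewrite map_cyclotomic_rat -(minCpoly_cyclotomic w_prim).
by rewrite -h.
Qed.

Lemma cyclotomic_rat_neq0 : cyclotomic_rat n != 0.
Proof.
rewrite -(map_poly_eq0 (ratr : {rmorphism rat -> algC})) map_cyclotomic_rat.
by rewrite monic_neq0 // cyclotomic_monic.
Qed.

Lemma evp_compN a x : evp x (a \Po - 'X) = evp (- x) a.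
Proof.
by rewrite /evp map_comp_poly horner_comp rmorphN /= map_polyX !hornerE.
Qed.

Lemma comp_polyNK (a : {poly rat}) : (a \Po - 'X) \Po - 'X = a.
Proof. by rewrite -comp_polyA rmorphN /= comp_polyX opprK comp_polyXr. Qed.

(** Substituting -q is an involution, so divisibility transfers from [w] to [- w]. *)
Lemma cyclotomic_compN_min a : (cyclotomic_rat n \Po - 'X %| a) = (evp (- w) a == 0).
Proof.
rewrite -evp_compN -cyclotomic_rat_min; apply/idP/idP => /dvdpP[c e].
  by rewrite e comp_polyM comp_polyNK dvdp_mull.
by rewrite -(comp_polyNK a) e comp_polyM dvdp_mull.
Qed.

Lemma cyclotomic_compN_neq0 : cyclotomic_rat n \Po - 'X != 0.
Proof.
apply: contraNneq cyclotomic_rat_neq0 => e.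
by rewrite -[cyclotomic_rat n]comp_polyNK e comp_poly0.
Qed.

(** If Phi_n(-q) vanished at [w], then [- w] would be a primitive n-th root of unity. *)
Lemma coprimep_cyclotomic_compN : (- w) ^+ n != 1 ->
  coprimep (cyclotomic_rat n \Po - 'X) (cyclotomic_rat n).
Proof.
move=> wn; apply: (coprimep_evp cyclotomic_rat_neq0 cyclotomic_rat_min).
rewrite evp_compN; apply: contra wn.
rewrite /evp map_cyclotomic_rat -/(root _ _) root_cyclotomic // => h.
by rewrite prim_expr_order.
Qed.

End Cyclotomic.

(** * Assembly from the orders at [- w] and [w] *)

Theorem theorem1p2 (n : nat) (n_gt1 : (1 < n)%N) (n_odd : odd n) :
  let q := qvar in
  congr_ratfun
    ((cyclotomic_rat n \Po - 'X) ^+ 4 * cyclotomic_rat n ^+ 2)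
    (\sum_(0 <= k < n) \sum_(0 <= j < k.+1) c_q j * c_q (k - j))
    (qint n (q ^+ 2) ^+ 2 * q ^+ ((n - 1) ^ 2)
     * (\sum_(0 <= k < ((n - 1) %/ 2).+1)
          qpoch (q ^+ 2) (q ^+ 4) k ^+ 3
          / qpochs [:: q ^+ 4; q ^+ 3; q ^+ 5] (q ^+ 4) k
          * q ^+ (2 * k)) ^+ 2).
Proof.
have [w w_prim] := C_prim_root_exists (ltnW n_gt1).
pose N := n./2.
have nE : n = (2 * N + 1)%N by rewrite -[LHS]odd_double_half n_odd mul2n addnC.
have N_gt0 : (0 < N)%N by lia.
(* Squaring keeps the order because [n] is odd; this serves [w] and [- w] alike. *)
have w2_prim : n.-primitive_root (w ^+ 2).
  by rewrite (prim_root_exp_coprime _ w_prim) coprime2n.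
have wn1 : w ^+ n = 1 by rewrite prim_expr_order.
have wnN : (- w) ^+ n = -1 by rewrite exprNn wn1 mulr1 -signr_odd n_odd.
move=> q.
have -> : qint n (q ^+ 2) ^+ 2 * q ^+ ((n - 1) ^ 2)
     * (\sum_(0 <= k < ((n - 1) %/ 2).+1)
          qpoch (q ^+ 2) (q ^+ 4) k ^+ 3
          / qpochs [:: q ^+ 4; q ^+ 3; q ^+ 5] (q ^+ 4) k
          * q ^+ (2 * k)) ^+ 2
  = ((-1) ^+ N * q ^+ (2 * N ^ 2) * qint (2 * N + 1) (q ^+ 2)
         * \sum_(j < N.+1) qpoch (q ^+ 2) (q ^+ 4) j ^+ 3
            / qpochs [:: q ^+ 4; q ^+ 3; q ^+ 5] (q ^+ 4) j * q ^+ (2 * j)) ^+ 2.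
  rewrite (_ : (n - 1) %/ 2 = N)%N; last by lia.
  rewrite (_ : (n - 1) ^ 2 = 2 * N ^ 2 * 2)%N; last by lia.
  rewrite big_mkord -nE !exprMn sqrr_sign mul1r -exprM.
  by congr (_ * _); rewrite mulrC.
apply: congr_ratfun_ordge.
- exact: cyclotomic_compN_neq0 w_prim.
- exact: cyclotomic_rat_neq0 w_prim.
- apply: coprimep_cyclotomic_compN w_prim _.
  by rewrite wnN -subr_eq0 -opprD oppr_eq0 two_neq0.
(* The exponents 4 and 2 are [2 + 2 * m] with m = 1 at [- w] and m = 0 at [w]. *)
- rewrite [X in index_iota 0 X]nE; apply: (@ordge_main (- w) _ N _ _ _ _ 1) => //.
  + by rewrite -nE sqrrN.
  + exact: cyclotomic_compN_neq0 w_prim.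
  + exact: cyclotomic_compN_min w_prim.
  + by right; rewrite -nE.
- rewrite [X in index_iota 0 X]nE; apply: (@ordge_main w _ N _ _ _ _ 0) => //.
  + by rewrite -nE.
  + exact: cyclotomic_rat_neq0 w_prim.
  + exact: cyclotomic_rat_min w_prim.
  + by left.
Qed.
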